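(* Let $k\geq2$ and $C_0\geq1$. There are constants $c_{k,C_0},C'_{k,C_0}>0$ such that the following holds. Let $N\geq 1$, let $0<\delta<c_{k,C_0}$, let $H$ be a positive integer, set $B=N/H$, and assume $$B\geq C'_{k,C_0}\delta^{-1},\qquad H\geq C'_{k,C_0}\delta^{-2^{k-1}}.$$ Let $\lambda\colon\mathbb Z^k\to\mathbb C$ be $1$-bounded and supported on $([-C_0B,C_0B]\cap\mathbb Z)^k$, and let $f_1,\ldots,f_k\colon\mathbb Z\to\mathbb C$ be $1$-bounded and supported on $[N]$. If $$|R_H(\lambda;f_1,\ldots,f_k)|\geq\delta B^k\frac{N^2}{B},$$ then, for every $1\leq i\leq k$, $$\|f_i\|_{U^k[N]}\gg_{k,C_0}\frac{\delta^{2^{k-1}}}{(\log(2/\delta))^{(2^{k-1}-1)/2^k}}.$$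
   Context: For a real number $X\geq1$, $[X]=\{1,\ldots,\lfloor X\rfloor\}$. A function is $1$-bounded if its values have modulus at most $1$. $X\gg_{k,C_0}Y$ means $X\geq c\,Y$ with $c>0$ depending only on $k,C_0$. Counting operator: $\displaystyle R_H(\lambda;f_1,\ldots,f_k)=\sum_{\mathbf b\in\mathbb Z^k}\lambda(\mathbf b)\sum_{x\in\mathbb Z}\sum_{m\in[H]}\prod_{i=1}^kf_i(x+b_im).$ Gowers norms: for finitely supported $f\colon\mathbb Z\to\mathbb C$, $$\|f\|_{U^s(\mathbb Z)}=\Bigl(\sum_{x,h_1,\ldots,h_s\in\mathbb Z}\prod_{\omega\in\{0,1\}^s}\mathcal C^{|\omega|}f(x+\omega\cdot\mathbf h)\Bigr)^{1/2^s},$$ where $\mathcal C$ is complex conjugation, $|\omega|=\sum_j\omega_j$ and $\omega\cdot\mathbf h=\sum_j\omega_jh_j$; and $\|f\|_{U^s[N]}=\|f1_{[N]}\|_{U^s(\mathbb Z)}/\|1_{[N]}\|_{U^s(\mathbb Z)}$. *)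

(* Defs.v *)
From HB Require Import structures.
From mathcomp Require Import all_boot all_order all_algebra.
From mathcomp Require Import all_classical all_reals all_analysis.
From mathcomp Require Import complex.

Set Implicit Arguments.
Unset Strict Implicit.
Unset Printing Implicit Defensive.

Import Order.TTheory GRing.Theory Num.Theory.

Local Open Scope classical_set_scope.
Local Open Scope ring_scope.
Local Open Scope complex_scope.

(* [X] = {1, ..., floor X} for a real X, as a set of integers *)
Definition bracket (R : realType) (X : R) : set int :=
  [set n : int | 1 <= n <= Num.floor X].

Definition one_bounded (R : realType) (T : Type) (f : T -> R[i]) : Prop :=
  forall x, `|f x| <= 1.

Definition supported_on (R : realType) (T : Type) (f : T -> R[i]) (A : set T)
  : Prop := forall x, f x != 0 -> A x.

(* Sums \sum_(x \in A) over infinite A are sums of finitely supported families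
   (the library gives them the value 0 otherwise).  Here the sum over b is
   finite when lam is finitely supported, and the sum over x is finite when
   k > 0 and the f_i are finitely supported. *)
Definition counting_op (R : realType) (k H : nat)
    (lam : {ffun 'I_k -> int} -> R[i]) (f : 'I_k -> int -> R[i]) : R[i] :=
  \sum_(b \in [set: {ffun 'I_k -> int}])
    lam b * \sum_(x \in [set: int])
      \sum_(1 <= m < H.+1) \prod_(i < k) f i (x + b i * m%:Z).

(* The factor C^{|w|} f (x + w . h), with w in {0,1}^s and C conjugation *)
Definition gowers_factor (R : realType) (s : nat) (f : int -> R[i]) (x : int)
    (h : {ffun 'I_s -> int}) (w : {ffun 'I_s -> bool}) : R[i] :=
  iter (\sum_j w j)%N (@conjc R) (f (x + \sum_j (w j)%:Z * h j)).

Definition gowers_sum (R : realType) (s : nat) (f : int -> R[i]) : R[i] :=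
  \sum_(xh \in [set: int * {ffun 'I_s -> int}])
    \prod_(w : {ffun 'I_s -> bool}) gowers_factor f xh.1 xh.2 w.

(* For s > 0 and f finitely supported, gowers_sum s f is a nonnegative real
   number, so that taking its real part loses nothing. *)
Definition gowers_norm (R : realType) (s : nat) (f : int -> R[i]) : R :=
  complex.Re (gowers_sum s f) `^ (1 / 2 ^+ s).

Definition gowers_norm_on (R : realType) (s : nat) (N : R) (f : int -> R[i])
  : R :=
  gowers_norm s (fun x => f x * \1_(bracket N) x) /
  gowers_norm s (\1_(bracket N) : int -> R[i]).

(* Main.v *)
(* Everything is transported to Z/P for a prime P so large that no wrap-around
   occurs. With Delta_n f(x) = f(x) conj(f(x+n)), let V_0 f = |sum f|^2 and
   V_(s+1) f = sum_n V_s(Delta_n f): then V_s is the Gowers sum of order s+1,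
   and Cauchy-Schwarz gives V_s^2 <= (3N)^(s+1) V_(s+1). It suffices to bound
   V_(k-1)(f_i) from below. Let A(n) = sum_x Delta_n f_i(x), D = floor(C0 B).

   If B >= K delta^-2, freeze all coordinates of b but the i-th. Cauchy-Schwarz
   in (x, m) removes the other functions, and its diagonal is negligible, so
   sum_(d <= 2D) |sum_m A(dm)| >> delta^2 N^2. A second Cauchy-Schwarz bounds
   the square of the left side by N sum_(d,d',m,m') |A(dm - d'm')|. For fixed
   d, d' each value dm - d'm' is taken O(H gcd(d,d')/d') times, and
   sum_(d,d') (gcd(d,d')/d')^(1/2) = O(D^(3/2)), without logarithm; hence
   V_1(f_i) >> delta^8 N^3.

   If B < K delta^-2, the b with b_j = b_i for some j <> i contribute little
   since B >= C'/delta, so some other b has an inner sum >> delta N H.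
   Eliminating the f_j one at a time by Cauchy-Schwarz bounds the 2^k-th power
   of this sum by a multiple of V_(k-1)(f_i), and H >> delta^2 N is not too
   small. *)
Require Import Defs.
From HB Require Import structures.
From mathcomp Require Import all_boot all_order all_algebra.
From mathcomp Require Import all_classical all_reals all_analysis.
From mathcomp Require Import complex.
From mathcomp Require Import ring lra zify.

Set Implicit Arguments.
Unset Strict Implicit.
Unset Printing Implicit Defensive.

Import Order.TTheory GRing.Theory Num.Theory.
Import Normc.

Local Open Scope classical_set_scope.
Local Open Scope ring_scope.
Local Open Scope complex_scope.

(** * Cauchy-Schwarz for finite real and complex sums *)

Section FiniteSums.
Variable R : rcfType.
Implicit Types (I J : finType).

(** Lagrange's identity: the squares of [a i * b j - a j * b i], summed over all pairs, give twice
    the difference of the two sides. *)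
Lemma sum_cauchy_schwarz I (P : pred I) (a b : I -> R) :
  (\sum_(i | P i) a i * b i) ^+ 2 <=
  (\sum_(i | P i) a i ^+ 2) * (\sum_(i | P i) b i ^+ 2).
Proof.
have h : 0 <= \sum_(i | P i) \sum_(j | P j) (a i * b j - a j * b i) ^+ 2.
  by apply: sumr_ge0 => i _; apply: sumr_ge0 => j _; exact: sqr_ge0.
set X := \sum_(i | P i) a i ^+ 2; set Y := \sum_(i | P i) b i ^+ 2.
set Z := \sum_(i | P i) _.
suff E : \sum_(i | P i) \sum_(j | P j) (a i * b j - a j * b i) ^+ 2 =
    X * Y + Y * X - (Z * Z) *+ 2 by move: h; rewrite E; lra.
rewrite /X /Y /Z !big_distrlr /= -sumrMnl -big_split -sumrB /=.
apply: eq_bigr => i _; rewrite -sumrMnl -big_split -sumrB /=.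
by apply: eq_bigr => j _; ring.
Qed.

Lemma sum_sqr_le I (P : pred I) (a : I -> R) :
  (\sum_(i | P i) a i) ^+ 2 <= #|P|%:R * \sum_(i | P i) a i ^+ 2.
Proof.
have := sum_cauchy_schwarz P (fun=> 1) a.
under eq_bigr do rewrite mul1r.
by under [X in _ <= X * _]eq_bigr do rewrite expr1n; rewrite sumr_const.
Qed.

Lemma sum_exp2_le I (P : pred I) (a : I -> R) t : (forall i, 0 <= a i) ->
  (\sum_(i | P i) a i) ^+ (2 ^ t) <=
  #|P|%:R ^+ (2 ^ t - 1) * \sum_(i | P i) a i ^+ (2 ^ t).
Proof.
move=> a0; elim: t => [|t IH]; first by rewrite expr1 mul1r.
rewrite expnSr exprM; apply: (le_trans (lerXn2r 2 _ _ IH)).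
- by rewrite nnegrE exprn_ge0 // sumr_ge0.
- by rewrite nnegrE mulr_ge0 ?exprn_ge0 // sumr_ge0 // => i _; rewrite exprn_ge0.
rewrite exprMn -exprM; have -> : (2 ^ t * 2 - 1 = (2 ^ t - 1) * 2 + 1)%N.
  by have := expn_gt0 2 t; lia.
rewrite exprD expr1 -mulrA ler_wpM2l ?exprn_ge0 //.
under [in leRHS]eq_bigr do rewrite exprM.
exact: sum_sqr_le.
Qed.

Lemma normc_ge0 (x : R[i]) : 0 <= normc x.
Proof. by case: x => a b /=; exact: sqrtr_ge0. Qed.

(** The modulus on [R[i]] is complex-valued, so estimates are made with the real-valued [normc];
    this lemma and the next two translate. *)
Lemma normr_normc (x : R[i]) : `|x| = (normc x)%:C.
Proof. by case: x. Qed.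

Lemma normr_le_real (x : R[i]) (a : R) : (`|x| <= a%:C) = (normc x <= a).
Proof. by rewrite normr_normc lecR. Qed.

Lemma normr_ge_real (x : R[i]) (a : R) : (a%:C <= `|x|) = (a <= normc x).
Proof. by rewrite normr_normc lecR. Qed.

Lemma normc_conj (x : R[i]) : normc x^* = normc x.
Proof. by case: x => a b /=; rewrite sqrrN. Qed.

Lemma normc_real (x : R) : 0 <= x -> normc x%:C = x.
Proof. by move=> x0; rewrite /= expr0n addr0 sqrtr_sqr ger0_norm. Qed.

Lemma normc_sum I (P : pred I) (a : I -> R[i]) :
  normc (\sum_(i | P i) a i) <= \sum_(i | P i) normc (a i).
Proof.
elim/big_ind2: _ => //; first by rewrite normc0.
by move=> x x' y y' hx hy; apply: le_trans (le_normcD _ _) (lerD hx hy).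
Qed.

Lemma normc_prod_le1 I (P : pred I) (a : I -> R[i]) :
  (forall i, normc (a i) <= 1) -> normc (\prod_(i | P i) a i) <= 1.
Proof.
move=> a1; elim/big_ind: _ => //; first by rewrite normc1.
by move=> x y hx hy; rewrite normcM mulr_ile1 ?normc_ge0.
Qed.

Lemma normc_sum_le_card I (P : pred I) (a : I -> R[i]) :
  (forall i, normc (a i) <= 1) -> normc (\sum_(i | P i) a i) <= #|P|%:R.
Proof.
move=> a1; apply: le_trans (normc_sum _ _) _.
by rewrite -sumr_const ler_sum.
Qed.

Lemma mul_conj (x : R[i]) : x * x^* = (normc x ^+ 2)%:C.
Proof. by rewrite -sqr_normc normr_normc rmorphXn. Qed.

Lemma normc_sum_cauchy_schwarz I (P : pred I) (a b : I -> R[i]) :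
  normc (\sum_(i | P i) a i * b i) ^+ 2 <=
  (\sum_(i | P i) normc (a i) ^+ 2) * (\sum_(i | P i) normc (b i) ^+ 2).
Proof.
apply: le_trans (sum_cauchy_schwarz _ _ _).
rewrite lerXn2r ?nnegrE ?normc_ge0 //.
  by apply: sumr_ge0 => i _; rewrite mulr_ge0 ?normc_ge0.
by apply: le_trans (normc_sum _ _) _; under eq_bigr do rewrite normcM.
Qed.

Lemma sum_normc_sqr_le_card I (a : I -> R[i]) :
  (forall i, normc (a i) <= 1) ->
  \sum_i normc (a i) ^+ 2 <= #|[pred i | a i != 0]|%:R.
Proof.
move=> a1; rewrite -sumr_const [leRHS]big_mkcond; apply: ler_sum => i _.
rewrite inE; case: eqP => [->|_]; first by rewrite normc0 expr0n.
by rewrite expr_le1 ?normc_ge0.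
Qed.

(** The form of Cauchy-Schwarz used throughout: the bounded weight [w], with at most [M] nonzero
    values, disappears, and the opened square correlates [F] with itself. *)
Lemma normc_weighted_sum_sqr_le I J (P : pred J) (w : I -> R[i])
    (F : I -> J -> R[i]) (M : R) : (forall i, normc (w i) <= 1) ->
  #|[pred i | w i != 0]|%:R <= M ->
  normc (\sum_i w i * \sum_(j | P j) F i j) ^+ 2 <=
  M * normc (\sum_(j | P j) \sum_(j' | P j') \sum_i F i j * (F i j')^*).
Proof.
move=> w1 wM; apply: le_trans (normc_sum_cauchy_schwarz _ _ _) _.
(* The double sum is a sum of squared moduli, so taking its modulus loses nothing. *)
have -> : \sum_(j | P j) \sum_(j' | P j') \sum_i F i j * (F i j')^* =
    (\sum_i normc (\sum_(j | P j) F i j) ^+ 2)%:C.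
  rewrite rmorph_sum /=.
  under [RHS]eq_bigr do rewrite -mul_conj rmorph_sum big_distrlr /=.
  by under eq_bigr do rewrite exchange_big /=; rewrite exchange_big.
have ge0 : 0 <= \sum_i normc (\sum_(j | P j) F i j) ^+ 2.
  by apply: sumr_ge0 => i _; exact: sqr_ge0.
rewrite normc_real // ler_wpM2r //.
exact: le_trans (sum_normc_sqr_le_card w1) wM.
Qed.

End FiniteSums.

(** * Gowers sums and multiplicative derivatives on a finite abelian group *)

Section Gowers.
Variables (R : rcfType) (G : finZmodType).
Implicit Types (f : G -> R[i]) (n x : G) (E : {set G}).

Definition mdiff f n x : R[i] := f x * (f (x + n))^*.

Fixpoint gowersV s f : R :=
  if s is s'.+1 then \sum_n gowersV s' (mdiff f n) else normc (\sum_x f x) ^+ 2.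

Definition autocorr f n : R[i] := \sum_x mdiff f n x.

(** This condition passes to every [mdiff f n] and makes [mdiff f n] vanish for [n] outside [E], so
    the losses in Cauchy-Schwarz depend on [#|E|] and not on the size of [G]. *)
Definition diffs_in E f := forall x n, f x != 0 -> f (x + n) != 0 -> n \in E.

Lemma gowersV_ge0 s f : 0 <= gowersV s f.
Proof.
elim: s f => [|s IH] f /=; first exact: sqr_ge0.
by apply: sumr_ge0 => n _; exact: IH.
Qed.

Lemma eq_gowersV s f g : f =1 g -> gowersV s f = gowersV s g.
Proof.
elim: s f g => [|s IH] f g fg /=; first by under eq_bigr do rewrite fg.
by apply: eq_bigr => n _; apply: IH => x; rewrite /mdiff !fg.
Qed.

Lemma gowersV_eq0 s f : (forall x, f x = 0) -> gowersV s f = 0.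
Proof.
elim: s f => [|s IH] f f0 /=.
  by under eq_bigr do rewrite f0; rewrite big1_eq normc0 expr0n.
by apply: big1 => n _; apply: IH => x; rewrite /mdiff f0 mul0r.
Qed.

Lemma mdiff_neq0 f n x : (mdiff f n x != 0) = (f x != 0) && (f (x + n) != 0).
Proof. by rewrite /mdiff mulf_eq0 conjc_eq0 negb_or. Qed.

Lemma normc_mdiff_le1 f n x : (forall x, normc (f x) <= 1) ->
  normc (mdiff f n x) <= 1.
Proof. by move=> f1; rewrite normcM normc_conj mulr_ile1 ?normc_ge0. Qed.

Lemma card_supp_mdiff f n :
  (#|[pred x | mdiff f n x != 0%R]| <= #|[pred x | f x != 0%R]|)%N.
Proof.
by apply/subset_leq_card/fintype.subsetP => x; rewrite !inE mdiff_neq0 => /andP[].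
Qed.

Lemma diffs_in_mdiff E f n : diffs_in E f -> diffs_in E (mdiff f n).
Proof.
move=> fE x m; rewrite !mdiff_neq0 => /andP[fx _] /andP[fxm _]; exact: fE fx fxm.
Qed.

Lemma mdiff_eq0 E f n x : diffs_in E f -> n \notin E -> mdiff f n x = 0.
Proof.
move=> fE nE; apply/eqP; rewrite -[_ == _]negbK mdiff_neq0.
by apply/negP => /andP[h1 h2]; rewrite (fE _ _ h1 h2) in nE.
Qed.

Lemma gowersVS_restrict E s f : diffs_in E f ->
  gowersV s.+1 f = \sum_(n in E) gowersV s (mdiff f n).
Proof.
move=> fE /=; rewrite [RHS]big_mkcond; apply: eq_bigr => n _.
case: ifPn => // nE; apply: gowersV_eq0 => x; exact: mdiff_eq0 nE.
Qed.

Lemma sum_autocorr f : \sum_n autocorr f n = (gowersV 0 f)%:C.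
Proof.
rewrite /= -mul_conj rmorph_sum mulr_suml exchange_big /=.
apply: eq_bigr => x _; rewrite mulr_sumr.
by rewrite [RHS](reindex_inj (addrI x)).
Qed.

Lemma autocorrN f n : autocorr f (- n) = (autocorr f n)^*.
Proof.
rewrite /autocorr rmorph_sum /= (reindex_inj (addIr n)) /=.
by apply: eq_bigr => x _; rewrite /mdiff addrK rmorphM /= conjcK mulrC.
Qed.

Lemma gowersV1 f : gowersV 1 f = \sum_n normc (autocorr f n) ^+ 2.
Proof. by []. Qed.

(** Cauchy-Schwarz over [n] in [E]: for [s = 0] applied to the autocorrelations, whose sum is
    [gowersV 0 f]; in the induction step the square of each term is bounded by the induction
    hypothesis. *)
Lemma gowersV_sqr_le E s f : diffs_in E f ->
  gowersV s f ^+ 2 <= #|E|%:R ^+ s.+1 * gowersV s.+1 f.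
Proof.
elim: s f => [|s IH] f fE.
  rewrite (gowersVS_restrict _ fE) expr1.
  have -> : gowersV 0 f = normc (\sum_(n in E) autocorr f n).
    have -> : \sum_(n in E) autocorr f n = \sum_n autocorr f n.
      rewrite big_mkcond; apply: eq_bigr => n _; case: ifPn => // nE.
      by rewrite /autocorr big1 // => x _; exact: mdiff_eq0 nE.
    by rewrite sum_autocorr normc_real ?gowersV_ge0.
  apply: le_trans (sum_sqr_le _ _).
  by rewrite lerXn2r ?nnegrE ?normc_ge0 ?normc_sum // sumr_ge0 // => *; exact: normc_ge0.
rewrite (gowersVS_restrict _ fE) (gowersVS_restrict s.+1 fE).
apply: le_trans (sum_sqr_le _ _) _; rewrite exprS -mulrA ler_wpM2l //.
by rewrite mulr_sumr ler_sum // => n _; exact/IH/diffs_in_mdiff.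
Qed.

(** Trivial bound, meant for the normalising factor of the Gowers norm. *)
Lemma gowersV_le E s f (M : R) : diffs_in E f -> (forall x, normc (f x) <= 1) ->
  #|[pred x | f x != 0]|%:R <= M -> gowersV s f <= #|E|%:R ^+ s * M ^+ 2.
Proof.
elim: s f => [|s IH] f fE f1 fM.
  rewrite mul1r lerXn2r ?nnegrE ?normc_ge0 //; first exact: le_trans fM.
  apply: le_trans fM.
  rewrite (bigID (fun x => f x != 0)) /= [X in _ + X]big1 => [|x].
    by rewrite addr0; exact: normc_sum_le_card.
  by rewrite negbK => /eqP.
rewrite (gowersVS_restrict _ fE) exprS -mulrA mulr_natl -sumr_const.
apply: ler_sum => n _; apply: IH; first exact: diffs_in_mdiff.
  by move=> x; exact: normc_mdiff_le1.
by apply: le_trans fM; rewrite ler_nat card_supp_mdiff.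
Qed.

(* The diagonal terms n = 0 alone give a lower bound. *)
Lemma gowersV_ge_mdiff0 s f : (forall x, mdiff f 0 x = f x) ->
  gowersV 0 f <= gowersV s f.
Proof.
move=> f0; elim: s => [//|s IH] /=; rewrite [leRHS](bigD1 0) //= (eq_gowersV s f0).
by rewrite ler_wpDr // sumr_ge0 // => n _; exact: gowersV_ge0.
Qed.

End Gowers.


(** * Removing functions from a linear configuration *)

Section LinearConfigurations.
Variables (R : rcfType) (F : finFieldType) (D : {set F}) (M Q : R).
Hypothesis M0 : 0 <= M.
Implicit Types (f : F -> R[i]) (gs : seq ((F -> R[i]) * F)) (A : {set F}).

Definition config_sum gs f (b : F) A : R[i] :=
  \sum_(m in A) \sum_x f (x + b * m) * \prod_(p <- gs) p.1 (x + p.2 * m).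

(** The loss after [t] eliminations: removing a function costs [M], and the power [2 ^ t] of a sum
    over [D] costs [#|D| ^ (2 ^ t - 1)]. *)
Fixpoint config_const t : R :=
  if t is t'.+1
  then M ^+ (2 ^ t) * #|D|%:R ^+ (2 ^ t - 1) * config_const t' else Q ^+ 2.

Lemma config_const_ge0 t : 0 <= config_const t.
Proof.
elim: t => [|t IH] /=; first exact: sqr_ge0.
by rewrite !mulr_ge0 ?exprn_ge0.
Qed.

Definition shift_diff (c h : F) (p : (F -> R[i]) * F) :=
  (mdiff p.1 ((p.2 - c) * h), p.2 - c).

(** A van der Corput step: translating [x] by a multiple of [c] frees [g] from [m], Cauchy-Schwarz
    in [x] removes it, and the two copies of [m] become [m] and [m + h]. *)
Lemma config_sum_sqr_le gs g c f b A :
  {in A &, forall m m', m' - m \in D} ->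
  (forall x, normc (g x) <= 1) -> #|[pred x | g x != 0]|%:R <= M ->
  normc (config_sum ((g, c) :: gs) f b A) ^+ 2 <=
  M * \sum_(h in D) normc (config_sum [seq shift_diff c h p | p <- gs]
        (mdiff f ((b - c) * h)) (b - c) [set m in A | m + h \in A]).
Proof.
move=> AD g1 gM.
pose P x m := f (x + (b - c) * m) * \prod_(p <- gs) p.1 (x + (p.2 - c) * m).
have -> : config_sum ((g, c) :: gs) f b A = \sum_x g x * \sum_(m in A) P x m.
  under [RHS]eq_bigr do rewrite mulr_sumr.
  rewrite [RHS]exchange_big /=; apply: eq_bigr => m _.
  rewrite [RHS](reindex_inj (addIr (c * m))) /=; apply: eq_bigr => x _.
  rewrite big_cons /= mulrCA; congr (_ * _); rewrite /P; congr (_ * _).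
    by congr f; ring.
  by apply: eq_bigr => p _; congr (p.1 _); ring.
apply: le_trans (normc_weighted_sum_sqr_le _ _ g1 gM) _.
rewrite ler_wpM2l //; apply: le_trans (normc_sum _ _).
rewrite le_eqVlt; apply/orP; left; apply/eqP; congr normc.
transitivity (\sum_(m in A) \sum_(h in D | m + h \in A)
    \sum_x P x m * (P x (m + h))^*).
  apply: eq_bigr => m mA; rewrite (reindex_inj (addrI m)) /=.
  apply: eq_bigl => h; case: (boolP (m + h \in A)) => mh; last by rewrite andbF.
  by have := AD _ _ mA mh; rewrite addrC addKr => ->.
under eq_bigr do rewrite big_mkcondr.
rewrite exchange_big /=; apply: eq_bigr => h _; rewrite /config_sum.
rewrite big_set big_mkcondr /=; apply: eq_bigr => m _; case: ifP => // _.
apply: eq_bigr => x _; rewrite /P big_map /mdiff /= rmorphM rmorph_prod /=.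
rewrite mulrACA -big_split /=; congr (_ * (f _)^* * _); first by ring.
by apply: eq_bigr => p _; rewrite mulrDr addrA.
Qed.

(** Each elimination puts one derivative on [f]. In the end [f] stands alone, and the sum is [#|A|]
    times the sum of [f], which gives [gowersV 0]. *)
Lemma config_sum_le t gs f b A : size gs = t ->
  #|A|%:R <= Q -> {in A &, forall m m', m' - m \in D} ->
  (forall p, p \in [seq q.2 | q <- gs] -> p != b) ->
  (forall i, (i < t)%N -> let g := (nth (f, b) gs i).1 in
    (forall x, normc (g x) <= 1) /\ #|[pred x | g x != 0]|%:R <= M) ->
  normc (config_sum gs f b A) ^+ (2 ^ t.+1) <=
  config_const t * gowersV t f.
Proof.
elim: t gs f b A => [|t IH] [|[g c] gs] //= f b A => [_|[gst]] AQ AD gsb gs1.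
  rewrite /config_sum /=.
  under eq_bigr do under eq_bigr do rewrite big_nil mulr1.
  under eq_bigr => m _ do rewrite -(reindex_inj (addIr (b * m)) (P := xpredT) (F := f)).
  rewrite sumr_const -mulr_natl normcM exprMn.
  rewrite ler_wpM2r ?sqr_ge0 // lerXn2r ?nnegrE ?normc_ge0 //.
    exact: le_trans AQ.
  by rewrite (_ : _%:R = #|A|%:R%:C) ?normc_real // rmorph_nat.
have [g1 gM] := gs1 0%N isT.
rewrite expnS exprM.
set T := (2 ^ t.+1)%N.
have /= S0 h : 0 <= normc (config_sum [seq shift_diff c h p | p <- gs]
        (mdiff f ((b - c) * h)) (b - c) [set m in A | m + h \in A]).
  exact: normc_ge0.
apply: (@le_trans _ _ ((M * \sum_(h in D) normc (config_sum
    [seq shift_diff c h p | p <- gs]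
    (mdiff f ((b - c) * h)) (b - c) [set m in A | m + h \in A])) ^+ T)).
  rewrite lerXn2r ?nnegrE ?sqr_ge0 ?mulr_ge0 ?sumr_ge0 //.
  exact: config_sum_sqr_le.
rewrite exprMn /= -/T -!mulrA ler_wpM2l ?exprn_ge0 //.
apply: le_trans (sum_exp2_le _ _ S0) _; rewrite -/T ler_wpM2l ?exprn_ge0 //.
(* As [b - c] is invertible, [(b - c) * h] takes every value once, so the sum over [h] is at most
   the sum over all shifts in the next [gowersV]. *)
have bc : b - c != 0 by rewrite subr_eq0 eq_sym gsb // inE eqxx.
rewrite [in leRHS](reindex_inj (mulfI bc)) /= mulr_sumr.
rewrite [leLHS]big_mkcond /=; apply: ler_sum => h _.
case: ifP => hD; last by rewrite mulr_ge0 ?config_const_ge0 ?gowersV_ge0.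
apply: IH.
- by rewrite size_map.
- apply: le_trans AQ; rewrite ler_nat; apply/subset_leq_card.
  by apply/fintype.subsetP => m; rewrite inE => /andP[].
- by move=> m m'; rewrite !inE => /andP[mA _] /andP[m'A _]; exact: AD.
- move=> p; rewrite (_ : map _ _ = [seq q - c | q <- map snd gs]); last first.
    by rewrite -!map_comp.
  by move=> /mapP[q qgs ->]; rewrite (inj_eq (addIr _)) gsb // inE qgs orbT.
move=> i igs; rewrite (nth_map (f, b)) ?gst //=; have [/= h1 h2] := gs1 i.+1 igs.
split=> [x|]; first exact: normc_mdiff_le1.
by apply: le_trans h2; rewrite ler_nat card_supp_mdiff.
Qed.

End LinearConfigurations.

(** * Square roots of gcds on average *)

Section GcdSums.
Variable R : rcfType.

Lemma sum_multiples (g n : nat) (phi : nat -> R) : (0 < g)%N ->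
  \sum_(d < n | (g %| d.+1)%N) phi d.+1 = \sum_(a < (n %/ g)%N) phi (g * a.+1)%N.
Proof.
move=> g0; elim: n => [|n IH]; first by rewrite div0n !big_ord0.
rewrite big_mkcond big_ord_recr /= -big_mkcond /= IH divnS //.
case: (boolP (g %| n.+1)%N) => [gn|_]; last by rewrite addr0 add0n.
rewrite add1n big_ord_recr /=; congr (_ + phi _).
by rewrite -[LHS](divnK gn) divnS // gn add1n mulnC.
Qed.

Lemma sum_inv_sqrt_le n :
  \sum_(a < n) (Num.sqrt a.+1%:R)^-1 <= 2 * Num.sqrt n%:R :> R.
Proof.
elim: n => [|n IH]; first by rewrite big_ord0 mulr_ge0 ?sqrtr_ge0.
rewrite big_ord_recr /=.
set s : R := Num.sqrt n.+1%:R; set r : R := Num.sqrt n%:R in IH *.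
have s0 : 0 < s by rewrite sqrtr_gt0 ltr0n.
have s2 : s ^+ 2 = r ^+ 2 + 1 by rewrite !sqr_sqrtr ?ler0n // -natr1.
have : s^-1 <= 2 * s - 2 * r.
  by rewrite -[s^-1]mulr1 ler_pdivrMl //; have := sqr_ge0 (s - r); nra.
lra.
Qed.

Lemma sum_inv_three_halves_le n :
  \sum_(a < n) (a.+1%:R * Num.sqrt a.+1%:R)^-1 <= 3 :> R.
Proof.
case: n => [|n]; first by rewrite big_ord0.
(* The bound is strengthened so that the induction telescopes. *)
apply: (@le_trans _ _ (3 - 2 / Num.sqrt n.+1%:R)); last first.
  by rewrite lerBlDr lerDl divr_ge0 ?sqrtr_ge0.
elim: n => [|n IH]; first by rewrite big_ord1 sqrtr1 mulr1 invr1; lra.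
rewrite big_ord_recr /=; apply: le_trans (lerD IH (lexx _)) _.
rewrite -[X in (X * _)^-1](sqr_sqrtr (ler0n R n.+2)).
set s : R := Num.sqrt n.+2%:R; set r : R := Num.sqrt n.+1%:R.
have s0 : 0 < s by rewrite sqrtr_gt0 ltr0n.
have r0 : 0 < r by rewrite sqrtr_gt0 ltr0n.
have s2 : s ^+ 2 = r ^+ 2 + 1 by rewrite !sqr_sqrtr ?ler0n // -[n.+2%:R]natr1.
have rs : r <= s by rewrite ler_sqrt ?ler_nat.
suff : (s ^+ 2 * s)^-1 <= 2 / r - 2 / s by lra.
have -> : 2 / r - 2 / s = 2 / (r * s * (s + r)).
  have E : (s - r) * (s + r) = 1 by nra.
  have -> : 2 / r - 2 / s = 2 * (s - r) / (r * s) by field; rewrite !gt_eqF.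
  by rewrite -[in RHS]E; field; rewrite !gt_eqF // addr_gt0.
rewrite ler_pdivlMr ?mulr_gt0 ?addr_gt0 // mulrC ler_pdivrMr ?mulr_gt0 ?exprn_gt0 //.
by have : 0 <= s * (2 * s ^+ 2 - r * (s + r)) by [rewrite mulr_ge0 //; nra]; nra.
Qed.

(** The square root of the gcd is at most the sum of the square roots of all common divisors [g].
    For fixed [g] the sums over [d] and [d'] separate, with values at most n / g and 2 sqrt(n) / g,
    and the series of g^(-3/2) converges. *)
Lemma sum_sqrt_gcd_le n :
  \sum_(d < n) \sum_(d' < n)
    (Num.sqrt (gcdn d.+1 d'.+1)%:R / Num.sqrt d'.+1%:R) <=
  6 * (n%:R * Num.sqrt n%:R) :> R.
Proof.
pose u (g d : nat) : R := ((g.+1 %| d.+1)%N)%:R.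
apply: (@le_trans _ _ (\sum_(g < n) Num.sqrt g.+1%:R * (\sum_(d < n) u g d) *
    (\sum_(d' < n) u g d' / Num.sqrt d'.+1%:R))).
  under [leRHS]eq_bigr do rewrite -mulrA big_distrlr mulr_sumr.
  rewrite [leRHS]exchange_big /=; apply: ler_sum => d _.
  under [leRHS]eq_bigr do rewrite mulr_sumr.
  rewrite [leRHS]exchange_big /=; apply: ler_sum => d' _.
  have g0 : (0 < gcdn d.+1 d'.+1)%N by rewrite gcdn_gt0.
  have gn : ((gcdn d.+1 d'.+1).-1 < n)%N.
    rewrite prednK //; apply: leq_trans (ltn_ord d).
    by apply: dvdn_leq => //; exact: dvdn_gcdl.
  rewrite (bigD1 (Ordinal gn)) //= /u prednK // dvdn_gcdl dvdn_gcdr !mul1r.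
  by rewrite lerDl sumr_ge0.
have -> : 6 * (n%:R * Num.sqrt n%:R) = 2 * (n%:R * Num.sqrt n%:R) * 3 :> R by ring.
apply: (@le_trans _ _ (\sum_(g < n) 2 * (n%:R * Num.sqrt n%:R) *
    (g.+1%:R * Num.sqrt g.+1%:R)^-1)); last first.
  by rewrite -mulr_sumr ler_wpM2l ?sum_inv_three_halves_le ?mulr_ge0 ?sqrtr_ge0.
apply: ler_sum => g _; set s : R := Num.sqrt g.+1%:R.
have s0 : 0 < s by rewrite sqrtr_gt0 ltr0n.
have gs : g.+1%:R = s ^+ 2 by rewrite sqr_sqrtr.
have ng : (n %/ g.+1)%N%:R <= n%:R / s ^+ 2.
  by rewrite ler_pdivlMr ?exprn_gt0 // -gs -natrM ler_nat leq_trunc_div.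
have -> : \sum_(d < n) u g d = (n %/ g.+1)%N%:R.
  rewrite /u -[RHS]mulr_natl mulr1 -[in RHS](card_ord (n %/ g.+1)%N) -sumr_const.
  rewrite -(sum_multiples n (fun=> 1)) // [RHS]big_mkcond.
  by apply: eq_bigr => d _; case: ifP.
have sv : \sum_(d < n) u g d / Num.sqrt d.+1%:R <= 2 * (Num.sqrt n%:R / s) / s.
  have -> : \sum_(d < n) u g d / Num.sqrt d.+1%:R =
      (\sum_(a < (n %/ g.+1)%N) (Num.sqrt a.+1%:R)^-1) / s.
    rewrite mulr_suml; under [RHS]eq_bigr do rewrite -invfM mulrC -sqrtrM // -natrM.
    rewrite -(sum_multiples n (fun a => (Num.sqrt a%:R)^-1)) // [RHS]big_mkcond.
    by apply: eq_bigr => d _; rewrite /u; case: ifP; rewrite ?mul1r ?mul0r.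
  rewrite ler_wpM2r ?invr_ge0 ?(ltW s0) //.
  apply: le_trans (sum_inv_sqrt_le _) _; rewrite ler_wpM2l //.
  rewrite ler_pdivlMr // -sqrtrM ?ler0n // ler_sqrt ?ler0n // -natrM ler_nat.
  exact: leq_trunc_div.
have -> : 2 * (n%:R * Num.sqrt n%:R) / (g.+1%:R * s) =
    s * (n%:R / s ^+ 2) * (2 * (Num.sqrt n%:R / s) / s).
  by rewrite gs; field; rewrite gt_eqF.
apply: ler_pM => //.
- by rewrite mulr_ge0 ?sqrtr_ge0 ?ler0n.
- by apply: sumr_ge0 => d _; rewrite divr_ge0 ?sqrtr_ge0.
- by rewrite ler_wpM2l ?sqrtr_ge0.
Qed.

End GcdSums.

(** * Autocorrelations at differences of products *)

Lemma exists_phase (R : rcfType) (z : R[i]) :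
  exists2 c : R[i], normc c <= 1 & c * z = (normc z)%:C.
Proof.
have [->|z0] := eqVneq z 0.
  by exists 0; rewrite ?normc0 // mul0r.
have nz : normc z != 0 by apply: contra z0 => /eqP/eq0_normc ->.
exists (z^* * (normc z)^-1%:C).
  rewrite normcM normc_conj normc_real ?invr_ge0 ?normc_ge0 //.
  by rewrite divff.
by rewrite mulrAC [_ * z]mulrC mul_conj -rmorphM expr2 mulfK.
Qed.

Section BilinearAutocorrelation.
Variables (R : rcfType) (F : finFieldType) (W : nat).
Hypothesis natr_injW : forall a b : nat,
  (a <= W)%N -> (b <= W)%N -> a%:R = b%:R :> F -> a = b.
Implicit Types f : F -> R[i].

(** Let [e] be [d'.+1] divided by the gcd. The first components of two solutions are congruent
    modulo [e], and the first component fixes the second, so a solution is determined by the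
    quotient by [e] of its first component. *)
Lemma card_linear_solutions n H (d d' : 'I_n) (v : F) : (2 * (n * H) <= W)%N ->
  (#|[pred p : 'I_H * 'I_H |
     ((d.+1 * p.1.+1)%:R - (d'.+1 * p.2.+1)%:R)%R == v]| <=
   (H %/ (d'.+1 %/ gcdn d.+1 d'.+1)).+1)%N.
Proof.
move=> nHW; set e := (_ %/ gcdn _ _)%N; set g := gcdn d.+1 d'.+1 in e *.
have g0 : (0 < g)%N by rewrite gcdn_gt0.
have d'E : d'.+1 = (g * e)%N by rewrite mulnC divnK // dvdn_gcdr.
have dE : d.+1 = (g * (d.+1 %/ g))%N by rewrite mulnC divnK // dvdn_gcdl.
have e0 : (0 < e)%N by have := ltn0Sn d'; rewrite d'E muln_gt0 => /andP[].
have cop : coprime e (d.+1 %/ g).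
  have := coprime_egcdn; rewrite /coprime -(eqn_pmul2l g0) muln_gcdr -d'E -dE.
  by rewrite gcdnC muln1.
set S := [pred p | _].
pose phi (p : 'I_H * 'I_H) : 'I_(H %/ e).+1 := inord (p.1 %/ e).
rewrite -(card_ord (H %/ e).+1) -(card_in_imset (f := phi) (D := S)).
  exact: max_card.
have le_nH (a : 'I_n) (b : 'I_H) : (a.+1 * b.+1 <= n * H)%N by apply: leq_mul.
move=> p q; rewrite !inE => /eqP pv /eqP; rewrite -pv => pq.
move=> /(congr1 (@nat_of_ord _)); rewrite !inordK; last 2 first.
- by rewrite ltnS leq_div2r // ltnW.
- by rewrite ltnS leq_div2r // ltnW.
move=> pqe.
have /natr_injW E : (d.+1 * p.1.+1 + d'.+1 * q.2.+1)%:R =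
    (d.+1 * q.1.+1 + d'.+1 * p.2.+1)%:R :> F.
  have {pq} /eqP := pq; rewrite -subr_eq0 !natrD => /eqP pq0.
  by apply/eqP; rewrite -subr_eq0 -[eqbRHS]oppr0 -pq0; apply/eqP; ring.
(* Both sides are at most 2 n H, hence at most [W], so the equation in [F] holds between natural
   numbers. *)
have {}E : (d.+1 * p.1.+1 + d'.+1 * q.2.+1 = d.+1 * q.1.+1 + d'.+1 * p.2.+1)%N.
  apply: E; apply: leq_trans nHW; rewrite mul2n -addnn; exact: leq_add.
have pq1 : p.1 = q.1 :> nat.
  have : p.1.+1 = q.1.+1 %[mod e].
    have [i [j ij]] : exists i j, ((d.+1 %/ g) * p.1.+1 + e * i =
                                  (d.+1 %/ g) * q.1.+1 + e * j)%N.
      exists q.2.+1, p.2.+1; apply/eqP; rewrite -(eqn_pmul2l g0) !mulnDr !mulnA.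
      by rewrite -dE -d'E E.
    have : (d.+1 %/ g * p.1.+1 = d.+1 %/ g * q.1.+1 %[mod e])%N.
      have := congr1 (modn^~ e) ij; rewrite /= ![(e * _)%N]mulnC.
      by rewrite ![(_ + _ * e)%N]addnC !modnMDl.
    wlog le_qp : p q {pq pqe pv E i j ij} / (q.1 <= p.1)%N => [wl h|].
      by case/orP: (leq_total q.1 p.1) => [/wl|/wl H1]; [exact|rewrite H1].
    move=> /eqP; rewrite eqn_mod_dvd ?leq_mul // -mulnBr Gauss_dvdr // => h.
    by apply/eqP; rewrite eqn_mod_dvd.
  move=> /eqP; rewrite -[p.1.+1]addn1 -[q.1.+1]addn1 eqn_modDr => /eqP h.
  by rewrite (divn_eq p.1 e) (divn_eq q.1 e) pqe h.
have pq2 : p.2 = q.2 :> nat.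
  by move/eqP: E; rewrite pq1 eqn_add2l eqn_pmul2l // eqSS => /eqP.
by case: p q pq1 pq2 {pv pq pqe E} => [p1 p2] [q1 q2] /= /val_inj -> /val_inj ->.
Qed.

Definition autocorr_grid_sum f n H : R :=
  \sum_(d < n) \sum_(d' < n) \sum_(m < H) \sum_(m' < H)
    normc (autocorr f ((d.+1 * m.+1)%:R - (d'.+1 * m'.+1)%:R)).

Lemma autocorr_grid_sumC f n H :
  autocorr_grid_sum f n H = autocorr_grid_sum f H n.
Proof.
rewrite /autocorr_grid_sum.
under eq_bigr => d _ do rewrite exchange_big.
rewrite exchange_big; apply: eq_bigr => m _ /=.
under eq_bigr => d _ do rewrite exchange_big.
rewrite exchange_big; apply: eq_bigr => m' _ /=.
apply: eq_bigr => d _; apply: eq_bigr => d' _.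
by rewrite [(d.+1 * _)%N]mulnC [(d'.+1 * _)%N]mulnC.
Qed.

(** For fixed [d] and [d'], Cauchy-Schwarz over the other two variables and the count of solutions
    bound the inner sum by the constant [c] times [Num.sqrt] of the gcd over [d'.+1];
    [sum_sqrt_gcd_le] does the rest. *)
Lemma autocorr_grid_sum_sqr_le_wlog f n H : (n <= H)%N -> (2 * (n * H) <= W)%N ->
  autocorr_grid_sum f n H ^+ 2 <= 72 * (n * H)%:R ^+ 3 * gowersV 1 f.
Proof.
move=> nH nHW; have V0 := gowersV_ge0 1 f.
pose c : R := Num.sqrt (2 * H%:R ^+ 3 * gowersV 1 f).
have c2 : c ^+ 2 = 2 * H%:R ^+ 3 * gowersV 1 f.
  by rewrite sqr_sqrtr // !mulr_ge0 ?exprn_ge0.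
have T0 : 0 <= autocorr_grid_sum f n H.
  by do 4! (apply: sumr_ge0 => ? _); exact: normc_ge0.
suff : autocorr_grid_sum f n H <= c * (6 * (n%:R * Num.sqrt n%:R)).
  move=> h; apply: le_trans (lerXn2r 2 _ _ h) _; rewrite ?nnegrE //.
    by rewrite !mulr_ge0 ?sqrtr_ge0.
  rewrite !exprMn c2 sqr_sqrtr ?ler0n // natrM exprMn le_eqVlt; apply/orP; left.
  by apply/eqP; ring.
apply: le_trans (ler_wpM2l (sqrtr_ge0 _) (sum_sqrt_gcd_le R n)).
rewrite mulr_sumr; apply: ler_sum => d _; rewrite mulr_sumr; apply: ler_sum => d' _.
set g := gcdn _ _.
have g0 : (0 < g)%N by rewrite gcdn_gt0.
set r : R := Num.sqrt g%:R / _.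
have r0 : 0 <= r by rewrite divr_ge0 ?sqrtr_ge0.
have r2 : r ^+ 2 = g%:R / d'.+1%:R by rewrite expr_div_n !sqr_sqrtr.
pose u (p : 'I_H * 'I_H) : F := (d.+1 * p.1.+1)%:R - (d'.+1 * p.2.+1)%:R.
rewrite pair_bigA.
have cr0 : 0 <= c * r by rewrite mulr_ge0 // sqrtr_ge0.
rewrite -(@ler_pXn2r _ 2) ?nnegrE //; last first.
  by apply: sumr_ge0 => ? _; exact: normc_ge0.
apply: le_trans (sum_sqr_le _ _) _.
rewrite card_prod card_ord exprMn c2 r2 (partition_big u xpredT) //.
have cardR v : #|[pred p | u p == v]|%:R <= 2 * H%:R * (g%:R / d'.+1%:R) :> R.
  have := card_linear_solutions d d' v nHW; rewrite -(ler_nat R) => h.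
  apply: le_trans h _; rewrite -/g; set e := (_ %/ g)%N.
  have d'E : d'.+1 = (g * e)%N by rewrite mulnC divnK // dvdn_gcdr.
  have e0 : (0 < e)%N by have := ltn0Sn d'; rewrite d'E muln_gt0 => /andP[].
  have -> : g%:R / d'.+1%:R = e%:R^-1 :> R.
    by rewrite d'E natrM invfM mulVKf // pnatr_eq0 -lt0n.
  rewrite ler_pdivlMr ?ltr0n // -!natrM ler_nat mulSn.
  (* Here [n <= H] enters: the added 1 in H / e + 1 is at most H / e. *)
  have eH : (e <= H)%N.
    by apply: leq_trans nH; apply: leq_trans (ltn_ord d'); exact: leq_div.
  by have := leq_trunc_div H e; lia.
apply: (@le_trans _ _ ((H * H)%:R *
    (2 * H%:R * (g%:R / d'.+1%:R) * gowersV 1 f))); last first.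
  by rewrite le_eqVlt natrM; apply/orP; left; apply/eqP; ring.
rewrite ler_wpM2l // gowersV1 mulr_sumr; apply: ler_sum => v _.
rewrite (eq_bigr (fun=> normc (autocorr f v) ^+ 2)); last by move=> p /eqP <-.
rewrite sumr_const -[leLHS]mulr_natl ler_wpM2r ?sqr_ge0 //.
rewrite (eq_card (B := [pred p | u p == v])); first exact: cardR.
by move=> p; rewrite !inE.
Qed.

Lemma autocorr_grid_sum_sqr_le f n H : (2 * (n * H) <= W)%N ->
  autocorr_grid_sum f n H ^+ 2 <= 72 * (n * H)%:R ^+ 3 * gowersV 1 f.
Proof.
case/orP: (leq_total n H) => nH nHW; first exact: autocorr_grid_sum_sqr_le_wlog.
rewrite autocorr_grid_sumC [(n * H)%N]mulnC.
by apply: autocorr_grid_sum_sqr_le_wlog; rewrite 1?mulnC 1?[(H * n)%N]mulnC // mulnC.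
Qed.

(** Phases [c d] replace the moduli, so that Cauchy-Schwarz in [x] can remove [f x]; what is left
    are autocorrelations at differences of products. *)
Lemma sum_normc_autocorr_dilates_sqr_le f n H (M : R) :
  (forall x, normc (f x) <= 1) -> #|[pred x | f x != 0%R]|%:R <= M ->
  (\sum_(d < n) normc (\sum_(m < H) autocorr f (d.+1 * m.+1)%:R)) ^+ 2 <=
  M * autocorr_grid_sum f n H.
Proof.
move=> f1 fM.
have M0 : 0 <= M by apply: le_trans fM.
pose z (d : 'I_n) := \sum_(m < H) autocorr f (d.+1 * m.+1)%:R.
have [c c1 cE] : exists2 c : 'I_n -> R[i], forall d, normc (c d) <= 1 &
    forall d, c d * z d = (normc (z d))%:C.
  have ex d : {c : R[i] | (normc c <= 1) && (c * z d == (normc (z d))%:C)}.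
    by apply: sigW; have [c c1 cz] := exists_phase (z d); exists c; rewrite c1 cz eqxx.
  exists (fun d => sval (ex d)) => d; case: (ex d) => /= e /andP[e1 /eqP e2] //.
pose Fj (x : F) (p : 'I_n * 'I_H) := c p.1 * (f (x + (p.1.+1 * p.2.+1)%:R))^*.
have -> : \sum_(d < n) normc (z d) = normc (\sum_x f x * \sum_p Fj x p).
  under [in RHS]eq_bigr do rewrite mulr_sumr.
  rewrite exchange_big /= -(pair_bigA _ (fun (d : 'I_n) (m : 'I_H) =>
    \sum_x f x * (c d * (f (x + (d.+1 * m.+1)%:R))^*))) /=.
  rewrite -[LHS]normc_real; last by apply: sumr_ge0 => d _; exact: normc_ge0.
  rewrite rmorph_sum /=; congr normc; apply: eq_bigr => d _; rewrite -cE mulr_sumr.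
  by apply: eq_bigr => m _; rewrite mulr_sumr; apply: eq_bigr => x _; rewrite mulrCA.
apply: le_trans (normc_weighted_sum_sqr_le xpredT Fj f1 fM) _.
rewrite ler_wpM2l //; apply: le_trans (normc_sum _ _) _.
rewrite /autocorr_grid_sum.
rewrite -(pair_bigA _ (fun (d : 'I_n) (m : 'I_H) => normc (\sum_j' \sum_i
   Fj i (d, m) * (Fj i j')^*))) /=; apply: ler_sum => d _.
rewrite [leRHS]exchange_big /=; apply: ler_sum => m _.
apply: le_trans (normc_sum _ _) _.
rewrite -(pair_bigA _ (fun (d' : 'I_n) (m' : 'I_H) => normc (\sum_i
   Fj i (d, m) * (Fj i (d', m'))^*))) /=; apply: ler_sum => d' _.
apply: ler_sum => m' _.
have -> : \sum_i Fj i (d, m) * (Fj i (d', m'))^* =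
    c d * (c d')^* * autocorr f ((d.+1 * m.+1)%:R - (d'.+1 * m'.+1)%:R).
  rewrite /autocorr mulr_sumr (reindex_inj (addIr (- (d'.+1 * m'.+1)%:R))) /=.
  apply: eq_bigr => x _; rewrite /Fj /mdiff /= subrK.
  rewrite [X in _ * X = _](rmorphM (@conjc R)) /= conjcK.
  by rewrite mulrACA; congr (_ * _); rewrite mulrC addrAC addrA.
rewrite normcM; apply: ler_piMl; first exact: normc_ge0.
by rewrite normcM normc_conj mulr_ile1 ?normc_ge0.
Qed.

End BilinearAutocorrelation.

(** * Averages over one coefficient with bounded weights *)

Section DilateAverages.
Variables (R : rcfType) (F : finFieldType).
Implicit Types f : F -> R[i].

Lemma normc_autocorr_le f n (M : R) : (forall x, normc (f x) <= 1) ->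
  #|[pred x | f x != 0%R]|%:R <= M -> normc (autocorr f n) <= M.
Proof.
move=> f1 fM; apply: le_trans fM.
rewrite /autocorr (bigID (fun x => f x != 0)) /= [X in _ + X]big1 => [|x].
  by rewrite addr0; apply: normc_sum_le_card => x; exact: normc_mdiff_le1.
by rewrite negbK => /eqP fx; rewrite /mdiff fx mul0r.
Qed.

Lemma sum_delta_le1 L (c : nat) : \sum_(t < L) (t == c :> nat)%:R <= 1 :> R.
Proof.
case: (ltnP c L) => cL; last first.
  rewrite big1 ?ler01 // => t _; case: eqP => // tc.
  by have := ltn_ord t; rewrite tc ltnNge cL.
rewrite (bigD1 (Ordinal cL)) //= eqxx big1 ?addr0 // => t tc.
by case: eqP => // tc'; case/eqP: tc; apply: val_inj.
Qed.

(** Each distance from [t] is attained by at most two [t']; [y d] belongs to the distance [d.+1]. *)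
Lemma sum_differences_le L (t : 'I_L) (alpha : 'I_L -> R) (y : nat -> R) (c : R) :
  alpha t <= c -> (forall d, 0 <= y d) ->
  (forall t' : 'I_L, (t < t')%N -> alpha t' = y (t' - t).-1) ->
  (forall t' : 'I_L, (t' < t)%N -> alpha t' = y (t - t').-1) ->
  \sum_t' alpha t' <= c + 2 * \sum_(d < L.-1) y d.
Proof.
move=> tc y0 agt alt.
rewrite (bigD1 t) //=; apply: lerD => //.
(* Truncated subtraction may give an extra hit at 0. This only enlarges the upper bound, and each
   indicator still sums to at most 1 over [t']. *)
pose ind (t' d : nat) : R := (t' == t + d.+1)%N%:R + (t' == t - d.+1)%N%:R.
have ind0 t' d : 0 <= ind t' d by rewrite addr_ge0.
apply: (@le_trans _ _ (\sum_(t' < L) \sum_(d < L.-1) y d * ind t' d)).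
  have ge0 t' P : 0 <= \sum_(d < L.-1 | P d) y d * ind t' d.
    by apply: sumr_ge0 => d _; rewrite mulr_ge0.
  rewrite big_mkcond; apply: ler_sum => t' _; case: ifPn => // t't.
  have [tt'|tt'|/val_inj tt'] := ltngtP t t'; last by rewrite tt' eqxx in t't.
    have dL : ((t' - t).-1 < L.-1)%N by have := ltn_ord t'; lia.
    rewrite agt // (bigD1 (Ordinal dL)) //= ler_wpDr //.
    rewrite /ind (_ : (t' == _ :> nat)%N); last by apply/eqP; lia.
    by rewrite mulrDr mulr1 lerDl mulr_ge0.
  have dL : ((t - t').-1 < L.-1)%N by have := ltn_ord t; lia.
  rewrite alt // (bigD1 (Ordinal dL)) //= ler_wpDr //.
  rewrite /ind [X in (_ + (nat_of_bool X)%:R)](_ : _ = true); last by apply/eqP; lia.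
  by rewrite mulrDr mulr1 lerDr mulr_ge0.
rewrite exchange_big /= mulr_sumr; apply: ler_sum => d _.
rewrite -mulr_sumr mulrC ler_wpM2r // big_split /=.
by have := sum_delta_le1 L (t + d.+1); have := sum_delta_le1 L (t - d.+1); lra.
Qed.

(** Cauchy-Schwarz in [x] and [m] removes [g]. Correlating [t] with [t'], a translation of [x]
    cancels [e] and leaves the autocorrelation at a multiple of [t' - t]; the diagonal is bounded
    trivially. *)
Lemma dilate_average_sqr_le L H (lam : 'I_L -> R[i]) (g : F -> 'I_H -> R[i]) f
    (e : F) (M Q : R) :
  (forall t, normc (lam t) <= 1) -> (forall x m, normc (g x m) <= 1) ->
  #|[pred p : F * 'I_H | g p.1 p.2 != 0%R]|%:R <= Q ->
  (forall x, normc (f x) <= 1) -> #|[pred x | f x != 0%R]|%:R <= M ->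
  normc (\sum_t lam t * \sum_(m < H) \sum_x
           g x m * f (x + (t%:R - e) * m.+1%:R)) ^+ 2 <=
  Q * (L%:R * (H%:R * M + 2 * \sum_(d < L.-1)
         normc (\sum_(m < H) autocorr f (d.+1 * m.+1)%:R))).
Proof.
move=> lam1 g1 gQ f1 fM.
have Q0 : 0 <= Q by apply: le_trans gQ.
pose w (p : F * 'I_H) := g p.1 p.2.
pose Fj (p : F * 'I_H) (t : 'I_L) := lam t * f (p.1 + (t%:R - e) * p.2.+1%:R).
have -> : \sum_t lam t * (\sum_(m < H) \sum_x
     g x m * f (x + (t%:R - e) * m.+1%:R)) = \sum_p w p * \sum_t Fj p t.
  under [RHS]eq_bigr do rewrite mulr_sumr.
  rewrite [RHS]exchange_big /=; apply: eq_bigr => t _.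
  rewrite -(pair_bigA _ (fun x (m : 'I_H) => w (x, m) * Fj (x, m) t)) /=.
  rewrite exchange_big mulr_sumr /=; apply: eq_bigr => x _.
  by rewrite mulr_sumr; apply: eq_bigr => m _; rewrite mulrCA.
apply: le_trans (normc_weighted_sum_sqr_le xpredT Fj _ gQ) _; first by case.
rewrite ler_wpM2l //; apply: le_trans (normc_sum _ _) _.
rewrite mulr_natl -[X in _ *+ X]card_ord -sumr_const; apply: ler_sum => t _.
pose alpha (t' : 'I_L) :=
  normc (\sum_(m < H) autocorr f ((t'%:R - t%:R) * m.+1%:R)).
apply: le_trans (normc_sum _ _) _.
apply: (@le_trans _ _ (\sum_t' alpha t')).
  apply: ler_sum => t' _.
  have -> : \sum_p Fj p t * (Fj p t')^* =
      lam t * (lam t')^* * \sum_(m < H) autocorr f ((t'%:R - t%:R) * m.+1%:R).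
    rewrite -(pair_bigA _ (fun x (m : 'I_H) => Fj (x, m) t * (Fj (x, m) t')^*)) /=.
    rewrite exchange_big mulr_sumr; apply: eq_bigr => m _ /=.
    rewrite (reindex_inj (addIr (- ((t%:R - e) * m.+1%:R)))) mulr_sumr /=.
    apply: eq_bigr => x _; rewrite /Fj /mdiff /= subrK.
    rewrite [X in _ * X = _](rmorphM (@conjc R)) /= mulrACA; congr (_ * (f _ * (f _)^*)).
    by ring.
  rewrite normcM; apply: ler_piMl; first exact: normc_ge0.
  by rewrite normcM normc_conj mulr_ile1 ?normc_ge0.
apply: (sum_differences_le (t := t) (y := fun d =>
  normc (\sum_(m < H) autocorr f (d.+1 * m.+1)%:R))).
- apply: le_trans (normc_sum _ _) _.
  rewrite [leRHS]mulr_natl -[X in _ <= _ *+ X]card_ord -[leRHS]sumr_const.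
  apply: ler_sum => m _.
  exact: normc_autocorr_le.
- by move=> d; exact: normc_ge0.
- move=> t' tt'; congr normc; apply: eq_bigr => m _; congr autocorr.
  by rewrite natrM prednK ?subn_gt0 // natrB // ltnW.
- move=> t' t't; rewrite /alpha -normc_conj rmorph_sum; congr normc.
  apply: eq_bigr => m _; rewrite /= -autocorrN; congr autocorr.
  by rewrite natrM prednK ?subn_gt0 // natrB ?(ltnW t't) // -mulNr opprB.
Qed.

End DilateAverages.

(** * Averaging over one coordinate of a vector *)

Lemma exists_ge_average (R : realDomainType) (I : finType) (a : I -> R) : (0 < #|I|)%N ->
  exists i, \sum_j a j <= #|I|%:R * a i.
Proof.
move=> /card_gt0P[i0 _].
case: (@arg_maxP _ _ _ i0 xpredT a isT) => i _ imax; exists i.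
by rewrite mulr_natl -sumr_const ler_sum // => j _; exact: imax.
Qed.

Section CoordinateAverages.
Variables (I T : finType).
Implicit Types beta : {ffun I -> T}.

Definition upd beta i t : {ffun I -> T} :=
  [ffun j => if j == i then t else beta j].

Lemma updE beta i t : upd beta i t i = t.
Proof. by rewrite ffunE eqxx. Qed.

Lemma upd_id beta i : upd beta i (beta i) = beta.
Proof. by apply/ffunP => j; rewrite ffunE; case: eqP => // ->. Qed.

Lemma upd_upd beta i t t' : upd (upd beta i t) i t' = upd beta i t'.
Proof. by apply/ffunP => j; rewrite !ffunE; case: eqP. Qed.

(** Exchanging [t] with the [i]-th coordinate is an involution on pairs that turns the summand into
    [f beta], free of [t]. *)
Lemma sum_upd (V : nmodType) (f : {ffun I -> T} -> V) i :
  \sum_beta \sum_t f (upd beta i t) = (\sum_beta f beta) *+ #|T|.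
Proof.
rewrite pair_bigA /=.
pose phi (p : {ffun I -> T} * T) := (upd p.1 i p.2, p.1 i).
have phiK : involutive phi.
  by case=> beta t; rewrite /phi /= upd_upd updE upd_id.
rewrite (reindex_inj (inv_inj phiK)) /=.
under eq_bigr do rewrite upd_upd upd_id.
rewrite -(pair_bigA _ (fun beta (t : T) => f beta)) /= -sumrMnl.
by under eq_bigr do rewrite sumr_const.
Qed.

Lemma exists_large_fiber (R : rcfType) (f : {ffun I -> T} -> R[i]) i :
  (0 < #|T|)%N ->
  exists beta, #|T|%:R * normc (\sum_beta f beta) <=
    #|T|%:R ^+ #|I| * normc (\sum_t f (upd beta i t)).
Proof.
move=> T0.
have ff0 : (0 < #|{ffun I -> T}|)%N by rewrite card_ffun expn_gt0 T0.
have [beta h] := exists_ge_average (fun beta => normc (\sum_t f (upd beta i t))) ff0.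
exists beta; rewrite -natrX -card_ffun; apply: le_trans h.
rewrite mulr_natl -normcMn -(sum_upd _ i); exact: normc_sum.
Qed.

(** This is [sum_upd] for the indicator of a coincidence: given [beta], exactly one new value of the
    [i]-th coordinate agrees with the [j]-th. *)
Lemma card_coincidence i j : j != i ->
  (#|[pred beta : {ffun I -> T} | beta j == beta i]| * #|T| = #|T| ^ #|I|)%N.
Proof.
move=> ji; have := sum_upd (fun beta => (beta j == beta i : nat)) i.
have E beta : \sum_t (upd beta i t j == upd beta i t i : nat) = 1%N.
  rewrite (bigD1 (beta j)) //= updE ffunE (negPf ji) eqxx big1 // => t tb.
  by rewrite updE ffunE (negPf ji) eq_sym (negPf tb).
under eq_bigr do rewrite E.
rewrite sum1_card card_ffun => ->; rewrite -sum1_card big_mkcond /=.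
by rewrite -[RHS]mulr_natr natn; congr (_ * _)%N; apply: eq_bigr => beta _; case: eqP.
Qed.

End CoordinateAverages.

(** * Centred residues modulo a prime *)

Section CenteredRepresentatives.
Variable P : nat.
Hypothesis primeP : prime P.

(** The representative in [-P/2, P/2): integers of absolute value below P/2, negative ones included,
    are recovered from their residues. *)
Definition crep (y : 'F_P) : int :=
  if (2 * (y : nat) < P)%N then (y : nat)%:Z else (y : nat)%:Z - P%:Z.

Lemma intr_Fp_eq0 (z : int) : (z%:~R == 0 :> 'F_P) = (P %| `|z|)%N.
Proof.
have chP : P \in [pchar 'F_P] by exact: pchar_Fp.
case: z => n; first by rewrite (dvdn_pcharf chP).
by rewrite NegzE mulrNz oppr_eq0 abszN (dvdn_pcharf chP).
Qed.

Lemma crepK (y : 'F_P) : (crep y)%:~R = y.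
Proof.
have yE : (y : nat)%:~R = y by exact: natr_Zp.
rewrite /crep; case: ifP => // _; rewrite intrB yE.
by rewrite (_ : (P%:Z)%:~R = 0) ?subr0 //; apply/eqP; rewrite intr_Fp_eq0.
Qed.

Lemma crep_inj : injective crep.
Proof. exact: can_inj crepK. Qed.

Lemma abs_crep_le (y : 'F_P) : (2 * `|crep y| <= P)%N.
Proof.
have : (y < P)%N by have := ltn_ord y; rewrite [X in (_ < X)%N](Fp_cast primeP).
by rewrite /crep; case: ifP; lia.
Qed.

Lemma crep_intr (z : int) : (2 * `|z| < P)%N -> crep z%:~R = z.
Proof.
move=> zP; have := abs_crep_le z%:~R; have := crepK z%:~R.
move: (crep _) => w wz wP; apply/eqP; rewrite -subr_eq0 -absz_eq0.
have : (P %| `|w - z|)%N by rewrite -intr_Fp_eq0 intrB wz subrr.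
case: (posnP `|w - z|%N) => [-> //|pos] /(dvdn_leq pos); lia.
Qed.

Lemma crepP (y : 'F_P) (z : int) : y = z%:~R -> (2 * `|z| < P)%N -> crep y = z.
Proof. by move=> -> /crep_intr. Qed.

Lemma natr_Fp_inj (a b : nat) :
  (a < P)%N -> (b < P)%N -> a%:R = b%:R :> 'F_P -> a = b.
Proof.
move=> aP bP /(congr1 (fun y : 'F_P => nat_of_ord y)).
by rewrite /= !val_Fp_nat // !modn_small.
Qed.

End CenteredRepresentatives.

(** * Transfer of sums over the integers to sums over residues *)

Lemma fsum_transfer (R : rcfType) (T : choiceType) (Y : finType) (h : Y -> T)
    (g : T -> R[i]) : injective h -> (forall x, g x != 0 -> exists y, x = h y) ->
  \sum_(x \in [set: T]) g x = \sum_y g (h y).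
Proof.
move=> hinj hsupp.
rewrite -(@fsbig_widen _ _ _ _ (range h)) //; last first.
  move=> x [_ /= xh]; apply/eqP/negPn/negP => /hsupp[y xy].
  by apply: xh; exists y.
rewrite fsbig_image; last by move=> x y _ _ /hinj.
have -> : [set: Y] = [set` (xpredT : {pred Y})] by apply/seteqP; split.
apply/esym/bigfs; first exact: index_enum_uniq.
by move=> y _; rewrite mem_index_enum.
Qed.

Definition lift_Fp (R : rcfType) (P : nat) (f : int -> R[i]) (y : 'F_P) : R[i] :=
  f (crep y).

Section Transfer.
Variables (R : realType) (P M : nat).
Hypothesis primeP : prime P.
Implicit Types f : int -> R[i].

Definition in_interval f := forall x, f x != 0 -> (1 <= x <= M%:Z).

(** A nonzero term forces [x] to be at most M + D H in absolute value, so its points stay within M +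
    2 D H < P/2 and do not wrap around. For the other residues the factor at [ord0] vanishes on both
    sides. *)
Lemma config_transfer k H D (f : 'I_k.+1 -> int -> R[i]) (b : 'I_k.+1 -> int) :
  (forall i, in_interval (f i)) -> (forall i, `|b i| <= D)%N ->
  (2 * (M + 2 * (D * H)) < P)%N ->
  \sum_(x \in [set: int]) \sum_(1 <= m < H.+1) \prod_(i < k.+1) f i (x + b i * m%:Z) =
  \sum_(y : 'F_P) \sum_(m < H) \prod_(i < k.+1)
    lift_Fp (f i) (y + (b i)%:~R * m.+1%:R).
Proof.
move=> fM bD HP.
have bm (m : 'I_H) i : (`|(b i * m.+1%:Z)%R| <= D * H)%N.
  by rewrite abszM; apply: leq_mul; [exact: bD | exact: ltn_ord].
have small x (m : 'I_H) : f ord0 (x + b ord0 * m.+1%:Z) != 0%R -> (`|x| <= M + D * H)%N.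
  by move=> /(fM ord0); have := bm m ord0; lia.
under eq_fsbigr do rewrite big_add1 /= big_mkord.
rewrite (@fsum_transfer _ _ 'F_P (@crep P)); last 2 first.
- exact: crep_inj.
- move=> x; case: (pickP (fun m : 'I_H => f ord0 (x + b ord0 * m.+1%:Z) != 0)).
    move=> m /small xs _; exists x%:~R; rewrite crep_intr //; lia.
  move=> none /eqP[]; apply: big1 => m _; rewrite big_ord_recl.
  by move/(_ m): none => /negbFE/eqP ->; rewrite mul0r.
apply: eq_bigr => y _; apply: eq_bigr => m _.
case: (leqP `|crep y| (M + D * H)) => ys.
  apply: eq_bigr => i _; congr (f i _); apply/esym/crepP => //.
    by rewrite intrD intrM crepK.
  by have := bm m i; lia.
rewrite !big_ord_recl.
have -> : f ord0 (crep y + b ord0 * m.+1%:Z) = 0.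
  by apply/eqP/negPn/negP => /small; lia.
have -> : lift_Fp (f ord0) (y + (b ord0)%:~R * m.+1%:R) = 0.
  apply/eqP/negPn/negP; rewrite /lift_Fp; move E : (crep _) => z /(fM ord0) zM.
  have yE : y = (z - b ord0 * m.+1%:Z)%:~R.
    by rewrite intrB -E crepK // intrM addrK.
  by have := bm m ord0; have := crepP primeP yE; lia.
by rewrite !mul0r.
Qed.

(** With [gowers_sumF], a literal copy of the integer definition over residues, halfway to the
    recursive [gowersV]. *)
Definition gowers_factorF s (g : 'F_P -> R[i]) (y : 'F_P) (k : {ffun 'I_s -> 'F_P})
    (w : {ffun 'I_s -> bool}) : R[i] :=
  iter (\sum_j w j)%N (@conjc R) (g (y + \sum_j (w j)%:R * k j)).

Definition gowers_sumF s (g : 'F_P -> R[i]) : R[i] :=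
  \sum_(yk : 'F_P * {ffun 'I_s -> 'F_P})
    \prod_(w : {ffun 'I_s -> bool}) gowers_factorF g yk.1 yk.2 w.

Lemma iter_conjc_eq0 n (z : R[i]) : (iter n (@conjc R) z == 0) = (z == 0).
Proof. by elim: n => //= n IH; rewrite conjc_eq0. Qed.

Lemma iter_conjcM n (z z' : R[i]) :
  iter n (@conjc R) (z * z') = iter n (@conjc R) z * iter n (@conjc R) z'.
Proof. by elim: n => //= n ->; rewrite rmorphM. Qed.

(** Nonzero factors at the vertex 0 and at the unit vectors confine the base point and all shifts to
    absolute value at most [M]; every vertex then lies within s.+1 M < P/2 of 0. *)
Lemma gowers_transfer s f : in_interval f -> (2 * (s.+1 * M) < P)%N ->
  gowers_sum s f = gowers_sumF s (lift_Fp f).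
Proof.
move=> fM sMP.
pose h (yk : 'F_P * {ffun 'I_s -> 'F_P}) : int * {ffun 'I_s -> int} :=
  (crep yk.1, [ffun j => crep (yk.2 j)]).
have sumw (V : nzRingType) (k : {ffun 'I_s -> V}) j :
    \sum_j' (([ffun j' => j' == j] : {ffun 'I_s -> bool}) j')%:R * k j' = k j.
  rewrite (bigD1 j) //= ffunE eqxx mul1r big1 ?addr0 // => j' j'j.
  by rewrite ffunE (negPf j'j) mul0r.
have sum0 (V : nzRingType) (k : {ffun 'I_s -> V}) :
    \sum_j' (([ffun=> false] : {ffun 'I_s -> bool}) j')%:R * k j' = 0.
  by apply: big1 => j' _; rewrite ffunE mul0r.
have smallZ x k : \prod_(w : {ffun 'I_s -> bool}) gowers_factor f x k w != 0 ->
    (`|x| <= M)%N /\ forall j, (`|k j| <= M)%N.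
  move=> /prodf_neq0 nz.
  have nzw (w : {ffun 'I_s -> bool}) : f (x + \sum_j (w j)%:Z * k j) != 0.
    by have := nz w isT; rewrite /gowers_factor iter_conjc_eq0.
  have := nzw [ffun=> false].
  have -> : \sum_j (([ffun=> false] : {ffun 'I_s -> bool}) j)%:Z * k j = 0.
    by rewrite -[RHS](sum0 _ k); apply: eq_bigr => j _; rewrite natz.
  rewrite addr0 => /fM xM.
  split=> [|j]; first by lia.
  have := nzw [ffun j' => j' == j].
  have -> : \sum_j' (([ffun j' => j' == j] : {ffun 'I_s -> bool}) j')%:Z * k j' = k j.
    by rewrite -[RHS](sumw _ k); apply: eq_bigr => j' _; rewrite natz.
  by move=> /fM; lia.
have MP : (2 * M < P)%N by apply: leq_ltn_trans sMP; rewrite leq_mul // leq_pmull.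
have cint x : (`|x| <= M)%N -> crep (x%:~R : 'F_P) = x.
  by move=> xM; apply: crep_intr => //; lia.
rewrite /gowers_sum (@fsum_transfer _ _ _ h); last 2 first.
- move=> [y k] [y' k'] [] /crep_inj -> // kk'; congr pair; apply/ffunP => j.
  by move/ffunP/(_ j): kk'; rewrite !ffunE; exact: crep_inj.
- case=> x k /smallZ[/= xM kM]; exists (x%:~R, [ffun j => (k j)%:~R]).
  rewrite /h /= cint //; congr pair; apply/ffunP => j; rewrite !ffunE cint //.
apply: eq_bigr => -[y k] _ /=.
have [ykM|ykM] := boolP ((`|crep y| <= M)%N && [forall j, (`|crep (k j)| <= M)%N]).
  move/andP: ykM => [yM /forallP kM].
  apply: eq_bigr => w _; rewrite /gowers_factor /gowers_factorF /lift_Fp.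
  congr (iter _ _ (f _)); apply/esym/crepP => //.
    rewrite intrD crepK // rmorph_sum; congr (_ + _); apply: eq_bigr => j _.
    by rewrite ffunE /= intrM crepK.
  have : (`|(\sum_j (w j)%:Z * [ffun j => crep (k j)] j)%R| <= s * M)%N.
    rewrite -lez_nat abszE; apply: le_trans (ler_norm_sum _ _ _) _.
    rewrite PoszM -[X in X%:Z * _]card_ord -natz mulr_natl -sumr_const.
    apply: ler_sum => j _; rewrite ffunE; have := kM j.
    by case: (w j); rewrite ?mul1r ?mul0r; lia.
  move: sMP; rewrite [(s.+1 * M)%N]mulSn; move: (s * M)%N (\sum_j _) => u S; lia.
transitivity (0 : R[i]).
  apply/eqP/negPn/negP => /smallZ[yM kM]; case/negP: ykM; rewrite yM.
  by apply/forallP => j; have := kM j; rewrite ffunE.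
apply/esym/eqP/negPn/negP => /prodf_neq0 nz; case/negP: ykM.
have nzw (w : {ffun 'I_s -> bool}) : f (crep (y + \sum_j (w j)%:R * k j)) != 0.
  by have := nz w isT; rewrite /gowers_factorF iter_conjc_eq0.
have := nzw [ffun=> false]; rewrite sum0 addr0 => /fM yM.
apply/andP; split; first by lia.
apply/forallP => j; have := nzw [ffun j' => j' == j]; rewrite sumw.
move E : (crep (y + _)) => z /fM zM.
have kE : k j = (z - crep y)%:~R.
  by rewrite intrB -E !crepK // addrC addKr.
by have := crepP primeP kE; lia.
Qed.

End Transfer.

(** * Gowers sums over residues in recursive form *)

Section FinfunCons.
Variables (s : nat) (A : Type).

Definition ffcons (p : A * {ffun 'I_s -> A}) : {ffun 'I_s.+1 -> A} :=
  [ffun j => if unlift ord0 j is Some j' then p.2 j' else p.1].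

Definition ffuncons (k : {ffun 'I_s.+1 -> A}) : A * {ffun 'I_s -> A} :=
  (k ord0, [ffun j => k (lift ord0 j)]).

Lemma ffcons0 p : ffcons p ord0 = p.1.
Proof. by rewrite ffunE unlift_none. Qed.

Lemma ffcons_lift p j : ffcons p (lift ord0 j) = p.2 j.
Proof. by rewrite ffunE liftK. Qed.

Lemma ffconsK : cancel ffcons ffuncons.
Proof.
case=> a k; rewrite /ffuncons ffcons0; congr pair.
by apply/ffunP => j; rewrite ffunE ffcons_lift.
Qed.

Lemma ffunconsK : cancel ffuncons ffcons.
Proof.
move=> k; apply/ffunP => j; case: (unliftP ord0 j) => [j'|] ->.
  by rewrite ffcons_lift ffunE.
by rewrite ffcons0.
Qed.

Lemma ffcons_bij : bijective ffcons.
Proof. exact: Bijective ffconsK ffunconsK. Qed.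

End FinfunCons.

Section GowersRecursion.
Variables (R : realType) (P : nat).
Implicit Types g : 'F_P -> R[i].

Lemma gowers_sumF0 g : gowers_sumF 0 g = \sum_y g y.
Proof.
rewrite /gowers_sumF -(pair_bigA _ (fun y (k : {ffun 'I_0 -> 'F_P}) =>
  \prod_(w : {ffun 'I_0 -> bool}) gowers_factorF g y k w)) /=.
have one (A : finType) : #|{ffun 'I_0 -> A}| = 1%N.
  by rewrite card_ffun card_ord expn0.
apply: eq_bigr => y _.
have E k (w : {ffun 'I_0 -> bool}) : gowers_factorF g y k w = g y.
  by rewrite /gowers_factorF !big_ord0 addr0.
under eq_bigr do under eq_bigr do rewrite E.
by rewrite prodr_const sumr_const !one.
Qed.

(** Split off the first shift [n] and the first bit of each vertex: two vertices differing only in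
    that bit combine into one factor of [mdiff g n]. *)
Lemma gowers_sumFS s g : gowers_sumF s.+1 g = \sum_n gowers_sumF s (mdiff g n).
Proof.
rewrite /gowers_sumF.
under [RHS]eq_bigr do rewrite -(pair_bigA _ (fun y (k : {ffun 'I_s -> 'F_P}) =>
  \prod_(w : {ffun 'I_s -> bool}) gowers_factorF (mdiff g _) y k w)) /=.
rewrite exchange_big -(pair_bigA _ (fun y (k : {ffun 'I_s.+1 -> 'F_P}) =>
  \prod_(w : {ffun 'I_s.+1 -> bool}) gowers_factorF g y k w)) /=.
apply: eq_bigr => y _; rewrite (reindex _ (onW_bij _ (ffcons_bij s 'F_P))) pair_bigA.
apply: eq_bigr => -[n k] _ /=.
rewrite (reindex _ (onW_bij _ (ffcons_bij s bool))) /=.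
rewrite -(pair_bigA _ (fun b w => gowers_factorF g y (ffcons (n, k)) (ffcons (b, w)))).
rewrite exchange_big /=; apply: eq_bigr => w _; rewrite big_bool /= mulrC.
have S b : (\sum_(i < s) ffcons (b, w) (lift ord0 i) = \sum_(i < s) w i)%N.
  by apply: eq_bigr => i _; rewrite ffcons_lift.
have T b : \sum_(i < s) (ffcons (b, w) (lift ord0 i))%:R *
    ffcons (n, k) (lift ord0 i) = \sum_(i < s) (w i)%:R * k i.
  by apply: eq_bigr => i _; rewrite !ffcons_lift.
rewrite /gowers_factorF !big_ord_recl !ffcons0 /= !S !T !add0n.
rewrite -iterS iterSr -iter_conjcM mul0r mul1r add0r /mdiff.
by rewrite [n + _]addrC addrA.
Qed.

Lemma gowers_sumF_gowersV s g : gowers_sumF s.+1 g = (gowersV s g)%:C.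
Proof.
elim: s g => [|s IH] g; rewrite gowers_sumFS.
  by under eq_bigr do rewrite gowers_sumF0; exact: sum_autocorr.
by under eq_bigr do rewrite IH; rewrite -rmorph_sum.
Qed.

Variable M : nat.
Hypothesis primeP : prime P.
Variable f : int -> R[i].
Hypothesis fM : in_interval M f.

Lemma gowers_sum_gowersV s : (2 * (s.+2 * M) < P)%N ->
  complex.Re (gowers_sum s.+1 f) = gowersV s (lift_Fp (P := P) f).
Proof. by move=> sMP; rewrite (gowers_transfer primeP fM sMP) gowers_sumF_gowersV. Qed.

Lemma card_supp_lift : (#|[pred y | lift_Fp (P := P) f y != 0%R]| <= M)%N.
Proof.
rewrite -[leqRHS]card_ord.
pose h (j : 'I_M) : 'F_P := j.+1%:R.
apply: leq_trans (leq_imset_card h (mem 'I_M)).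
apply/subset_leq_card/fintype.subsetP => y; rewrite inE => /fM.
case E : (crep y) => [n|n] // nM.
have jM : (n.-1 < M)%N by lia.
apply/imsetP; exists (Ordinal jM) => //; rewrite /h /= prednK; last by lia.
by rewrite -[LHS](crepK primeP) E.
Qed.

(** The residues of -M, ..., M, which include all differences of points of [1, M]. *)
Definition window : {set 'F_P} := [set (j%:R - M%:R) | j : 'I_(2 * M).+1].

Lemma card_window : (#|window| <= (2 * M).+1)%N.
Proof. by apply: leq_trans (leq_imset_card _ _) _; rewrite card_ord. Qed.

Lemma diffs_in_window : diffs_in window (lift_Fp (P := P) f).
Proof.
move=> y n /fM yM /fM ynM.
have nE : n = (crep (y + n) - crep y)%:~R.
  by rewrite intrB !crepK // addrC addKr.
move: nE yM ynM; case: (crep y) => [a|//]; case: (crep (y + n)) => [b|//] -> aM bM.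
have jM : (b + M - a < (2 * M).+1)%N by lia.
apply/imsetP; exists (Ordinal jM) => //=.
by rewrite natrB ?natrD ?intrB //; [ring | lia].
Qed.

End GowersRecursion.

(** * Sums with fixed coefficients and sums along one coordinate *)

Section BoxSums.
Variables (R : realType) (P : nat).
Hypothesis primeP : prime P.
Variables (t H L D : nat) (M : R) (g : 'I_t.+1 -> 'F_P -> R[i]).
Hypothesis g1 : forall i x, normc (g i x) <= 1.
Hypothesis gM : forall i, #|[pred x | g i x != 0%R]|%:R <= M.
Implicit Types beta : {ffun 'I_t.+1 -> 'I_L}.

Definition box_sum beta : R[i] :=
  \sum_y \sum_(m < H) \prod_i g i (y + ((beta i)%:R - D%:R) * m.+1%:R).

Let supp_bound_ge0 : 0 <= M.
Proof. exact: le_trans (gM ord0). Qed.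

Lemma box_sum_pow_le i beta : (L <= P)%N -> (H < P)%N ->
  (forall j, j != i -> beta j != beta i) ->
  normc (box_sum beta) ^+ (2 ^ t.+1) <=
  config_const (window P H) M H%:R t * gowersV t (g i).
Proof.
move=> LP HP betai.
pose b j : 'F_P := (beta j)%:R - D%:R.
pose gs := [seq (g j, b j) | j <- enum (predC1 i)].
pose A : {set 'F_P} := [set m.+1%:R | m : 'I_H].
have injA : injective (fun m : 'I_H => m.+1%:R : 'F_P).
  move=> m m' /natr_Fp_inj E; apply/val_inj/succn_inj/E => //.
    by have := ltn_ord m; lia.
  by have := ltn_ord m'; lia.
have sgs : size gs = t by rewrite size_map -cardE cardC1 card_ord.
have -> : box_sum beta = config_sum gs (g i) (b i) A.
  rewrite /config_sum big_imset /=; last by move=> m m' _ _ /injA.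
  rewrite /box_sum exchange_big; apply: eq_bigr => m _; apply: eq_bigr => y _ /=.
  rewrite (bigD1 i) //= big_map big_enum /=.
  by congr (_ * _).
refine (@config_sum_le R _ (window P H) M H%:R supp_bound_ge0 t gs (g i) (b i) A
  sgs _ _ _ _).
- by rewrite ler_nat; apply: leq_trans (leq_imset_card _ _) _; rewrite card_ord.
- move=> _ _ /imsetP[m _ ->] /imsetP[m' _ ->].
  have jH : (m'.+1 + H - m.+1 < (2 * H).+1)%N.
    by have := ltn_ord m; have := ltn_ord m'; lia.
  apply/imsetP; exists (Ordinal jH) => //=.
  by rewrite natrB ?natrD; [ring | have := ltn_ord m; lia].
- move=> p; rewrite -map_comp => /mapP[j]; rewrite mem_enum !inE => ji -> /=.
  rewrite (inj_eq (addIr _)); apply: contra (betai _ ji) => /eqP/natr_Fp_inj E.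
  apply/eqP/val_inj/E => //.
    exact: leq_trans (ltn_ord _) LP.
  exact: leq_trans (ltn_ord _) LP.
move=> l lt; rewrite /gs (nth_map i) /=; last by rewrite -cardE cardC1 card_ord.
by split.
Qed.

(** The functions other than [g i] form one function [G] of [x] and [m]. As [0 < t], some [g j] is
    among them, and its support bounds that of [G] by [H * M] after a shear. *)
Lemma box_sum_upd_sqr_le i beta (lam : 'I_L -> R[i]) : (0 < t)%N ->
  (forall c, normc (lam c) <= 1) ->
  normc (\sum_c lam c * box_sum (upd beta i c)) ^+ 2 <=
  (H%:R * M) * (L%:R * (H%:R * M + 2 * \sum_(d < L.-1)
    normc (\sum_(m < H) autocorr (g i) (d.+1 * m.+1)%:R))).
Proof.
move=> t0 lam1.
pose b j : 'F_P := (beta j)%:R - D%:R.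
pose G (x : 'F_P) (m : 'I_H) : R[i] := \prod_(j | j != i) g j (x + b j * m.+1%:R).
have -> : \sum_c lam c * box_sum (upd beta i c) =
    \sum_c lam c * \sum_(m < H) \sum_x G x m * g i (x + (c%:R - D%:R) * m.+1%:R).
  apply: eq_bigr => c _; congr (_ * _); rewrite /box_sum exchange_big.
  apply: eq_bigr => m _; apply: eq_bigr => x _ /=.
  rewrite (bigD1 i) //= updE mulrC; congr (_ * _).
  by apply: eq_bigr => j ji; rewrite ffunE (negPf ji).
apply: dilate_average_sqr_le => //.
  by move=> x m; apply: normc_prod_le1.
have [j ji] : exists j : 'I_t.+1, j != i.
  have : (0 < #|predC1 i|)%N by rewrite cardC1 card_ord.
  by case/card_gt0P => j ji; exists j.
pose phi (p : 'F_P * 'I_H) := (p.1 + b j * p.2.+1%:R, p.2).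
have phi_inj : injective phi.
  move=> [x m] [x' m'] /eqP; rewrite xpair_eqE /= => /andP[+ /eqP mm'].
  by rewrite mm' (inj_eq (addIr _)) => /eqP ->.
pose S : {set 'F_P} := [set x | g j x != 0%R]%SET.
have S_M : #|S|%:R <= M by apply: le_trans (gM j); rewrite ler_nat cardsE.
apply: (@le_trans _ _ (#|S| * H)%:R); last first.
  by rewrite natrM mulrC ler_wpM2l.
rewrite ler_nat -[X in (_ <= _ * X)%N]card_ord -cardsT -cardsX.
rewrite -(card_imset _ phi_inj); apply/subset_leq_card/fintype.subsetP => q.
move=> /imsetP[p]; rewrite inE => Gp -> ; rewrite !inE andbT /=.
by move: Gp; rewrite /G (bigD1 j) //= mulf_eq0 negb_or => /andP[].
Qed.

End BoxSums.

(** * Choice of a coefficient vector *)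

Section Pigeonhole.
Variables (R : realType) (P : nat).
Hypothesis primeP : prime P.
Variables (t H D M : nat).
Local Notation L := (2 * D).+1.
Implicit Types beta : {ffun 'I_t.+1 -> 'I_L}.

Definition box_point beta : {ffun 'I_t.+1 -> int} :=
  [ffun j => (beta j)%:Z - D%:Z].

Lemma counting_op_box (lam : {ffun 'I_t.+1 -> int} -> R[i])
    (f : 'I_t.+1 -> int -> R[i]) :
  (2 * (M + 2 * (D * H)) < P)%N -> (forall i, in_interval M (f i)) ->
  (forall b, lam b != 0 -> forall i, (`|b i| <= D)%N) ->
  counting_op H lam f = \sum_beta lam (box_point beta) *
    box_sum H D (fun i => lift_Fp (P := P) (f i)) beta.
Proof.
move=> HP fM lamD; rewrite /counting_op (@fsum_transfer _ _ _ box_point).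
- apply: eq_bigr => beta _; congr (_ * _).
  rewrite (config_transfer primeP fM (D := D)) //; last first.
    move=> i; rewrite ffunE; have := ltn_ord (beta i); move: (nat_of_ord _) => n.
    by set Z := (_ - _); have -> : Z = (n%:Z - D%:Z)%R by []; lia.
  apply: eq_bigr => y _; apply: eq_bigr => m _; apply: eq_bigr => i _.
  by rewrite ffunE intrB.
- move=> beta beta' E; apply/ffunP => j; move/ffunP/(_ j): E; rewrite !ffunE.
  by move=> /addIr[] /val_inj.
- move=> b; rewrite mulf_eq0 negb_or => /andP[/lamD bD _].
  have shift (z : int) : (`|z| <= D)%N -> 0 <= z + D%:Z /\ (`|(z + D%:Z)%R| < L)%N.
    by lia.
  have bL j : (`|(b j + D%:Z)%R| < L)%N by have [] := shift _ (bD j).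
  exists [ffun j => Ordinal (bL j)]; apply/ffunP => j; rewrite !ffunE /=.
  have [z0 _] := shift _ (bD j).
  by rewrite (gez0_abs z0) addrK.
Qed.

Variable g : 'I_t.+1 -> 'F_P -> R[i].
Variable Mr : R.
Hypothesis g1 : forall i x, normc (g i x) <= 1.
Hypothesis gM : forall i, #|[pred x | g i x != 0%R]|%:R <= Mr.

Lemma normc_box_sum_le beta : normc (box_sum H D g beta) <= H%:R * Mr.
Proof.
rewrite /box_sum exchange_big /=; apply: le_trans (normc_sum _ _) _.
rewrite [leRHS]mulr_natl -[X in _ <= _ *+ X]card_ord -[leRHS]sumr_const.
apply: ler_sum => m _; apply: le_trans (gM ord0).
pose c : 'F_P := ((beta ord0)%:R - D%:R) * m.+1%:R.
rewrite (reindex_inj (addIr (- c))) /=.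
rewrite (bigID (fun x => g ord0 x != 0)) /= [X in _ + X]big1 => [|x].
  by rewrite addr0; apply: normc_sum_le_card => x; exact: normc_prod_le1.
by rewrite negbK => /eqP gx; rewrite big_ord_recl subrK gx mul0r.
Qed.

(** The vectors with a coordinate equal to the [i]-th contribute at most S / 2 by counting and the
    trivial bound; the largest of the other terms is at least their average. *)
Lemma exists_distinct_large i (lam : {ffun 'I_t.+1 -> 'I_L} -> R[i]) (S : R) :
  (forall beta, normc (lam beta) <= 1) -> 0 < S ->
  2 * (t.+1%:R * L%:R ^+ t * (H%:R * Mr)) <= S ->
  S <= normc (\sum_beta lam beta * box_sum H D g beta) ->
  exists2 beta : {ffun 'I_t.+1 -> 'I_L},
      (forall j, j != i -> beta j != beta i) &
    S <= 2 * L%:R ^+ t.+1 * normc (box_sum H D g beta).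
Proof.
move=> lam1 S0 HS SR.
pose good (beta : {ffun 'I_t.+1 -> 'I_L}) := [forall j, (j != i) ==> (beta j != beta i)].
pose a beta : R := if good beta then normc (box_sum H D g beta) else 0.
have HM0 : 0 <= H%:R * Mr.
  by rewrite mulr_ge0 //; apply: le_trans (gM ord0).
have bad_le : #|[pred beta | ~~ good beta]|%:R <= t.+1%:R * L%:R ^+ t :> R.
  rewrite -(ler_pM2r (ltr0Sn R (2 * D))) -mulrA -exprSr -natrX -!natrM ler_nat.
  apply: (@leq_trans ((\sum_(j | j != i)
      #|[pred beta : {ffun 'I_t.+1 -> 'I_L} | beta j == beta i]|) * L)%N).
    apply: leq_mul => //.
    rewrite -sum1_card; under [leqRHS]eq_bigr do rewrite -sum1_card big_mkcond.
    rewrite exchange_big big_mkcond /=; apply: leq_sum => beta _.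
    case: ifPn => // /forallPn[j]; rewrite negb_imply negbK => /andP[ji bji].
    by rewrite (bigD1 j) //= inE bji.
  rewrite big_distrl /=.
  apply: (@leq_trans (\sum_(j < t.+1 | j != i) L ^ t.+1)%N).
    apply: leq_sum => j ji; have := card_coincidence 'I_L ji.
    by rewrite !card_ord => ->.
  by rewrite sum_nat_const leq_mul2r -[X in (_ <= X)%N]card_ord max_card orbT.
have ff0 : (0 < #|{ffun 'I_t.+1 -> 'I_L}|)%N.
  by rewrite card_ffun expn_gt0 !card_ord.
have [beta hb] := exists_ge_average a ff0.
rewrite card_ffun !card_ord natrX in hb.
have aS : S / 2 <= \sum_beta a beta.
  have : S <= \sum_beta (a beta + (~~ good beta)%:R * (H%:R * Mr)).
    apply: le_trans SR _; apply: le_trans (normc_sum _ _) _.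
    apply: ler_sum => beta' _; rewrite normcM.
    apply: (@le_trans _ _ (normc (box_sum H D g beta'))).
      by rewrite ler_piMl ?normc_ge0.
    rewrite /a; case: (good _) => /=; first by rewrite mul0r addr0.
    by rewrite add0r mul1r normc_box_sum_le.
  rewrite big_split /= -mulr_suml -natr_sum.
  have -> : (\sum_beta' (~~ good beta') = #|[pred beta | ~~ good beta]|)%N.
    rewrite -sum1_card [RHS]big_mkcond; apply: eq_bigr => b' _.
    by rewrite inE; case: (good b').
  have := ler_wpM2r HM0 bad_le; lra.
(* A bad maximiser would have [a beta = 0], contradicting 0 < S / 2. *)
have gb : good beta.
  move: hb; rewrite /a; case: (good beta) => //; rewrite mulr0 => h0.
  by exfalso; move: (le_trans aS h0); lra.
exists beta.
  by move=> j ji; move/forallP/(_ j): gb; rewrite ji.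
by move: hb; rewrite {2}/a gb => hb; have := le_trans aS hb; lra.
Qed.

End Pigeonhole.

(** * Numerical estimates for large and for small B *)

Lemma leq_exp2_succ t : (t.+2 <= 2 ^ t.+1)%N.
Proof. by elim: t => // t IH; rewrite expnS; lia. Qed.

Lemma leq_double_exp2 t : (2 * t <= 2 ^ t.+1)%N.
Proof. by rewrite expnS leq_mul2l /=; exact/ltnW/ltn_expl. Qed.

Section Estimates.
Variable R : realFieldType.

(** Here [m] is a support size, [l] counts the values of a coefficient and [n] their distances, [X]
    is a sum over one coordinate, [Y] the sum of dilated autocorrelations, and [V] is
    [gowersV 1]. *)
Lemma large_B_estimate (N h B d C0 a m l n X Y V : R) :
  0 < h -> 0 < B -> B * h = N -> 1 <= C0 -> 0 < d -> 0 < a -> 0 <= m <= N ->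
  0 <= l <= 3 * C0 * B -> 0 <= n <= 2 * C0 * B -> 0 <= Y -> 0 <= V ->
  a * d * (B * N * h) <= X ->
  X ^+ 2 <= h * m * (l * (h * m + 2 * Y)) ->
  Y ^+ 4 <= m ^+ 2 * (72 * (n * h) ^+ 3 * V) ->
  6 * C0 <= a ^+ 2 * d ^+ 2 * B ->
  (a ^+ 2 * d ^+ 2 / (12 * C0)) ^+ 4 / (576 * C0 ^+ 3) * N ^+ 3 <= V.
Proof.
move=> h0 B0 BhN C1 d0 a0 /andP[m0 mN] /andP[l0 lB] /andP[n0 nB] Y0 V0 Xge XY YV BC.
have C0p : 0 < C0 by lra.
have N0 : 0 < N by rewrite -BhN mulr_gt0.
set w := a ^+ 2 * d ^+ 2 in BC *.
have w0 : 0 < w by rewrite mulr_gt0 ?exprn_gt0.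
have hmN : h * m <= h * N by rewrite ler_wpM2l // ltW.
have hm0 : 0 <= h * m by rewrite mulr_ge0 // ltW.
have hN0 : 0 < h * N by rewrite mulr_gt0.
have X2 : w * (B * N * h) ^+ 2 <= h * N * (3 * C0 * B * (h * N + 2 * Y)).
  have -> : w * (B * N * h) ^+ 2 = (a * d * (B * N * h)) ^+ 2 by rewrite /w; ring.
  apply: (@le_trans _ _ (X ^+ 2)).
    rewrite lerXn2r ?nnegrE //; last by apply: le_trans Xge; rewrite !mulr_ge0 // ltW.
    by rewrite !mulr_ge0 // ltW.
  have mY0 : 0 <= h * m + 2 * Y by lra.
  apply: le_trans XY _; apply: (ler_pM hm0 (mulr_ge0 l0 mY0) hmN).
  by apply: (ler_pM l0 mY0 lB); rewrite lerD2r.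
have E1 : w * (B * (N * h)) <= 3 * C0 * (h * N + 2 * Y).
  have c0 : 0 < h * N * B by rewrite mulr_gt0.
  rewrite -(ler_pM2l c0); apply: le_trans (le_trans X2 _); rewrite le_eqVlt;
    by apply/orP; left; apply/eqP; ring.
(* So the diagonal is at most half of the left side of [E1], whence the 12 in [e]. *)
have E2 : 6 * C0 * (h * N) <= w * B * (h * N) by rewrite ler_wpM2r // ltW.
set e := w / (12 * C0).
have e0 : 0 < e by rewrite divr_gt0 // mulr_gt0.
have E3 : e * N ^+ 2 <= Y.
  have NN : B * (N * h) = N ^+ 2 by rewrite -BhN; ring.
  rewrite /e mulrAC ler_pdivrMr ?mulr_gt0 //.
  by rewrite -NN; have : w * B * (h * N) = w * (B * (N * h)) by [ring]; lra.
have nh : n * h <= 2 * C0 * N by rewrite -BhN mulrA ler_wpM2r // ltW.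
have nh0 : 0 <= n * h by rewrite mulr_ge0 // ltW.
have E4 : e ^+ 4 * N ^+ 8 <= 576 * C0 ^+ 3 * V * N ^+ 5.
  have -> : e ^+ 4 * N ^+ 8 = (e * N ^+ 2) ^+ 4 by ring.
  apply: (@le_trans _ _ (Y ^+ 4)).
    have eN0 : 0 <= e * N ^+ 2 by rewrite mulr_ge0 ?exprn_ge0 ?ltW.
    by rewrite lerXn2r ?nnegrE.
  apply: le_trans YV _.
  have -> : 576 * C0 ^+ 3 * V * N ^+ 5 = N ^+ 2 * (72 * (2 * C0 * N) ^+ 3 * V) by ring.
  have nhV : 72 * (n * h) ^+ 3 * V <= 72 * (2 * C0 * N) ^+ 3 * V.
    have CN0 : 0 <= 2 * C0 * N by rewrite !mulr_ge0 ?ltW.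
    by apply: (ler_wpM2r V0); rewrite ler_wpM2l // lerXn2r ?nnegrE.
  have nhV0 : 0 <= 72 * (n * h) ^+ 3 * V.
    by apply: mulr_ge0 => //; apply: mulr_ge0 => //; exact: exprn_ge0.
  have m2N : m ^+ 2 <= N ^+ 2 by rewrite lerXn2r ?nnegrE //; exact: ltW.
  exact: (ler_pM (exprn_ge0 2 m0) nhV0 m2N nhV).
have c576 : 0 < 576 * C0 ^+ 3.
  by apply: mulr_gt0; [rewrite ltr0n | exact: exprn_gt0].
rewrite mulrAC ler_pdivrMr // mulrC -(ler_pM2l (exprn_gt0 5 N0)).
apply: le_trans (le_trans E4 _); rewrite le_eqVlt;
  by apply/orP; left; apply/eqP; ring.
Qed.

(** With T = 2^(t+1), cancelling powers of [N] and [h] leaves (a d)^T N^2 h^t. The lower bound N d^2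
    / K0 for [h] makes the exponent of [d] equal to T + 2 t, at most 2 T. *)
Lemma small_B_estimate (t : nat) (N h B d K0 a S V : R) :
  0 < h -> B * h = N -> 0 < N -> 0 < d <= 1 -> 0 < a -> 0 < K0 ->
  B * d ^+ 2 <= K0 -> 0 <= V -> a * d * (N * h) <= S ->
  S ^+ (2 ^ t.+1) <= N ^+ (2 ^ t.+1 - 2) * (3 * h) ^+ (2 ^ t.+1 - 2 - t) * h ^+ 2 * V ->
  a ^+ (2 ^ t.+1) / (3 ^+ (2 ^ t.+1) * K0 ^+ t) * d ^+ (2 ^ t.+2) * N ^+ t.+2 <= V.
Proof.
move=> h0 BhN N0 /andP[d0 d1] a0 K00 BK V0 Sge SV.
rewrite [(2 ^ t.+2)%N]expnS; have [] := (leq_exp2_succ t, leq_double_exp2 t).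
move: (2 ^ t.+1)%N SV => T SV tT t2T.
have T2 : (2 <= T)%N by apply: leq_trans tT.
have tT' : (t <= T)%N by apply: leq_trans tT; rewrite -addn2 leq_addr.
have K1 : (a * d) ^+ T * (N ^+ 2 * h ^+ t) <= 3 ^+ T * V.
  have Z0 : 0 < N ^+ (T - 2) * h ^+ (T - t) by rewrite mulr_gt0 ?exprn_gt0.
  rewrite -(ler_pM2l Z0).
  have -> : N ^+ (T - 2) * h ^+ (T - t) * ((a * d) ^+ T * (N ^+ 2 * h ^+ t)) =
      (a * d * (N * h)) ^+ T.
    rewrite [RHS]exprMn [(N * h) ^+ T]exprMn.
    have -> : N ^+ T = N ^+ (T - 2) * N ^+ 2 by rewrite -exprD subnK.
    have -> : h ^+ T = h ^+ (T - t) * h ^+ t by rewrite -exprD subnK.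
    by ring.
  apply: (@le_trans _ _ (S ^+ T)).
    have Z1 : 0 <= a * d * (N * h) by rewrite !mulr_ge0 ?ltW.
    by rewrite lerXn2r ?nnegrE //; exact: le_trans Sge.
  apply: le_trans SV _; rewrite exprMn.
  have -> : h ^+ (T - t) = h ^+ (T - 2 - t) * h ^+ 2.
    by rewrite -exprD subnAC subnK // leq_subRL // addn2.
  set x := N ^+ _; set y := h ^+ (_ - _ - _).
  have -> : x * (3 ^+ (T - 2 - t) * y) * h ^+ 2 * V =
     x * (y * h ^+ 2) * (3 ^+ (T - 2 - t) * V) by ring.
  have xy0 : 0 <= x * (y * h ^+ 2) by rewrite !mulr_ge0 ?exprn_ge0 ?ltW.
  have h3 : 3 ^+ (T - 2 - t) <= 3 ^+ T :> R 
    by rewrite ler_weXn2l ?ler1n // -subnDA leq_subr.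
  by apply: (ler_wpM2l xy0); apply: (ler_wpM2r V0).
have hN : N * d ^+ 2 / K0 <= h.
  rewrite ler_pdivrMr // -BhN mulrAC mulrC ler_wpM2l //; exact: ltW.
have K2 : (N * d ^+ 2 / K0) ^+ t <= h ^+ t.
  have Z2 : 0 <= N * d ^+ 2 / K0 by rewrite !mulr_ge0 ?invr_ge0 ?exprn_ge0 ?ltW.
  by rewrite lerXn2r ?nnegrE //; exact: ltW.
have dT : d ^+ (2 * T) <= d ^+ T * (d ^+ 2) ^+ t.
  have le2 : (T + 2 * t <= 2 * T)%N by rewrite [leqRHS]mul2n -addnn leq_add2l.
  by rewrite -exprM -exprD; apply: ler_wiXn2l => //; exact: ltW.
have A0 : 0 < 3 ^+ T :> R by rewrite exprn_gt0.
have k0 : 0 < K0 ^+ t by rewrite exprn_gt0.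
rewrite -(ler_pM2l A0); apply: le_trans K1.
have -> : 3 ^+ T * (a ^+ T / (3 ^+ T * K0 ^+ t) * d ^+ (2 * T) * N ^+ t.+2) =
    a ^+ T * N ^+ t.+2 / K0 ^+ t * d ^+ (2 * T).
  by field; rewrite !gt_eqF.
apply: (@le_trans _ _ (a ^+ T * N ^+ t.+2 / K0 ^+ t * (d ^+ T * (d ^+ 2) ^+ t))).
  apply: ler_wpM2l dT.
  have aT0 : 0 <= a ^+ T by rewrite exprn_ge0 // ltW.
  have Nt0 : 0 <= N ^+ t.+2 by rewrite exprn_ge0 // ltW.
  have Kt0 : 0 <= (K0 ^+ t)^-1 by rewrite invr_ge0 ltW.
  exact: mulr_ge0 (mulr_ge0 aT0 Nt0) Kt0.
apply: (@le_trans _ _ ((a * d) ^+ T * (N ^+ 2 * (N * d ^+ 2 / K0) ^+ t))).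
  rewrite le_eqVlt; apply/orP; left; apply/eqP.
  by rewrite -addn2 exprD !exprMn exprVn; ring.
apply: ler_wpM2l; first by rewrite exprn_ge0 // mulr_ge0 ?ltW.
by apply: ler_wpM2l => //; rewrite exprn_ge0 // ltW.
Qed.

End Estimates.

(** * Lower bounds for Gowers sums over residues *)

Lemma config_const_closed (R : rcfType) (F : finFieldType) (D : {set F})
    (M Q : R) t : config_const D M Q t =
  M ^+ (2 ^ t.+1 - 2) * #|D|%:R ^+ (2 ^ t.+1 - 2 - t) * Q ^+ 2.
Proof.
elim: t => [|t /= ->]; first by rewrite !mul1r.
rewrite [(2 ^ t.+2)%N]expnS; have := leq_exp2_succ t.
move: (2 ^ t.+1)%N => T t1.
have -> : (2 * T - 2 = T + (T - 2))%N by lia.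
have -> : (T + (T - 2) - t.+1 = (T - 1) + (T - 2 - t))%N by lia.
by rewrite !exprD; ring.
Qed.

(** Squaring doubles the exponent of [d]; that of [N] goes from t + 3 to 2 (t + 3) - (t + 2) = t +
    4. *)
Lemma gowersV_iterate (R : realType) (k1 : R) t : 0 < k1 ->
  exists2 k2 : R, 0 < k2 &
  forall (G : finZmodType) (f : G -> R[i]) (E : {set G}) (N d : R),
    diffs_in E f -> #|E|%:R <= 3 * N -> 0 < N -> 0 <= d ->
    k1 * d ^+ 8 * N ^+ 3 <= gowersV 1 f ->
    k2 * d ^+ (2 ^ t.+3) * N ^+ t.+3 <= gowersV t.+1 f.
Proof.
move=> k10; elim: t => [|t [k2 k20 IH]]; first by exists k1.
exists (k2 ^+ 2 / 3 ^+ t.+2); first by rewrite divr_gt0 ?exprn_gt0.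
move=> G f E N d fE EN N0 d0 h; have {IH h} h := IH G f E N d fE EN N0 d0 h.
have h0 : 0 <= k2 * d ^+ (2 ^ t.+3) * N ^+ t.+3.
  have dt : 0 <= d ^+ (2 ^ t.+3) by exact: exprn_ge0.
  have Nt : 0 <= N ^+ t.+3 by rewrite exprn_ge0 // ltW.
  exact: mulr_ge0 (mulr_ge0 (ltW k20) dt) Nt.
have c0 : 0 < 3 ^+ t.+2 * N ^+ t.+2 by rewrite mulr_gt0 ?exprn_gt0.
have V0 : 0 <= gowersV t.+2 f by exact: gowersV_ge0.
rewrite -(ler_pM2l c0).
apply: (@le_trans _ _ (gowersV t.+1 f ^+ 2)); last first.
  apply: le_trans (gowersV_sqr_le _ fE) _; apply: (ler_wpM2r V0).
  by rewrite -exprMn lerXn2r ?nnegrE // mulr_ge0 // ltW.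
have -> : 3 ^+ t.+2 * N ^+ t.+2 *
    (k2 ^+ 2 / 3 ^+ t.+2 * d ^+ (2 ^ t.+4) * N ^+ t.+4) =
    (k2 * d ^+ (2 ^ t.+3) * N ^+ t.+3) ^+ 2.
  have -> : d ^+ (2 ^ t.+4) = (d ^+ (2 ^ t.+3)) ^+ 2 by rewrite -exprM -expnSr.
  have -> : N ^+ t.+4 = N ^+ t.+2 * N ^+ 2 by rewrite -exprD addn2.
  have -> : N ^+ t.+3 = N ^+ t.+2 * N by rewrite exprSr.
  by field; rewrite expf_neq0.
by rewrite lerXn2r ?nnegrE // gowersV_ge0.
Qed.

Lemma box_gowersV_lower (R : realType) (t : nat) (C0 : R) : (0 < t)%N -> 1 <= C0 ->
  exists k1 C' : R, [/\ 0 < k1, 1 <= C' &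
  forall (P H D M : nat) (N d : R) (g : 'I_t.+1 -> 'F_P -> R[i])
    (lam : {ffun 'I_t.+1 -> 'I_(2 * D).+1} -> R[i]),
  let B := N / H%:R in
  prime P -> (4 * (D * H) < P)%N -> (H < P)%N -> ((2 * D).+1 <= P)%N ->
  1 <= N -> (0 < H)%N -> 0 < d <= 1 -> C' <= d * B -> M%:R <= N ->
  D%:R <= C0 * B ->
  (forall i x, normc (g i x) <= 1) ->
  (forall i, #|[pred x | g i x != 0%R]|%:R <= M%:R :> R) ->
  (forall i, diffs_in (window P M) (g i)) ->
  (forall beta, normc (lam beta) <= 1) ->
  d * (B ^+ t.+1 * (N * H%:R)) <=
    normc (\sum_beta lam beta * box_sum H D g beta) ->
  forall i, k1 * d ^+ (2 ^ t.+2) * N ^+ t.+2 <= gowersV t (g i)].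
Proof.
move=> t0 C1.
have C0p : 0 < C0 by lra.
have C30 : 0 < 3 * C0 by lra.
(* As L <= 3 C0 B, [a1] pays for freezing [t] coordinates, and [a2] for averaging over all of them
   and for the half lost to coincidences. *)
pose a1 := (3 * C0) ^- t.
have a10 : 0 < a1 by rewrite invr_gt0 exprn_gt0.
pose a2 := (2 * (3 * C0) ^+ t.+1)^-1.
have a20 : 0 < a2 by rewrite invr_gt0 mulr_gt0 ?exprn_gt0.
(* Makes [K0 <= B * d ^+ 2] the last hypothesis of [large_B_estimate]. *)
pose K0 := 6 * C0 / a1 ^+ 2.
have K00 : 0 < K0 by rewrite divr_gt0 ?exprn_gt0 //; lra.
pose k0 := (a1 ^+ 2 / (12 * C0)) ^+ 4 / (576 * C0 ^+ 3).
have k00 : 0 < k0.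
  apply: divr_gt0; last by apply: mulr_gt0; [rewrite ltr0n | exact: exprn_gt0].
  apply: exprn_gt0; apply: divr_gt0; first exact: exprn_gt0.
  exact: mulr_gt0.
have [k1 k10 iter] := gowersV_iterate t.-1 k00.
pose k2 := a2 ^+ (2 ^ t.+1) / (3 ^+ (2 ^ t.+1) * K0 ^+ t).
have k20 : 0 < k2.
  apply: divr_gt0; first exact: exprn_gt0.
  by apply: mulr_gt0; exact: exprn_gt0.
(* Large enough for the coincidences to be negligible in [exists_distinct_large]. *)
pose C' := 2 * t.+1%:R * (3 * C0) ^+ t.
exists (Num.min k1 k2), C'; split.
- by rewrite lt_min k10.
- have : 1 <= (3 * C0) ^+ t by apply: exprn_ege1; lra.
  have : 1 <= t.+1%:R :> R by rewrite ler1n.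
  by rewrite /C'; nra.
move=> P H D M N d g lam B primeP P4 HP LP N1 H0 /andP[d0 d1] CdB MN DB.
move=> g1 gM gE lam1 SR i.
have N0 : 0 < N by lra.
have h0 : 0 < H%:R :> R by rewrite ltr0n.
have B0 : 0 < B by rewrite divr_gt0.
have BhN : B * H%:R = N by rewrite divfK // gt_eqF.
have C'1 : 1 <= C'.
  have : 1 <= (3 * C0) ^+ t by apply: exprn_ege1; lra.
  have : 1 <= t.+1%:R :> R by rewrite ler1n.
  by rewrite /C'; nra.
have B1 : 1 <= B by nra.
pose L := (2 * D).+1.
have LB : L%:R <= 3 * C0 * B.
  rewrite /L -natr1 natrM; have : 1 <= C0 * B by nra.
  lra.
have V0 s : 0 <= gowersV s (g i) by exact: gowersV_ge0.
have dpow0 : 0 <= d ^+ (2 ^ t.+2) by rewrite exprn_ge0 // ltW.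
have Npow0 : 0 <= N ^+ t.+2 by rewrite exprn_ge0 // ltW.
have L0 : 0 < L%:R :> R by rewrite ltr0n.
have LtB s : L%:R ^+ s <= (3 * C0 * B) ^+ s.
  by rewrite lerXn2r ?nnegrE // ?ltW // mulr_gt0.
have M0 : 0 <= M%:R :> R by [].
have minl : Num.min k1 k2 <= k1 by rewrite ge_min lexx.
have minr : Num.min k1 k2 <= k2 by rewrite ge_min lexx orbT.
have card_win m : (0 < m)%N -> #|window P m|%:R <= 3 * m%:R :> R.
  move=> m0; rewrite -natrM ler_nat; apply: leq_trans (card_window _ _) _.
  by rewrite mulSn -add1n leq_add2r.
case: (lerP K0 (B * d ^+ 2)) => BK.
  apply: (@le_trans _ _ (k1 * d ^+ (2 ^ t.+2) * N ^+ t.+2)).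
    by apply: (ler_wpM2r Npow0); apply: (ler_wpM2r dpow0).
  have L0' : (0 < #|'I_L|)%N by rewrite card_ord.
  have [beta] := exists_large_fiber
    (fun beta => lam beta * box_sum H D g beta) i L0'.
  set X := normc (\sum_(c : 'I_L) _).
  rewrite !card_ord exprS -mulrA ler_pM2l // => LX.
  pose Y := \sum_(e < 2 * D) normc (\sum_(m < H) autocorr (g i) (e.+1 * m.+1)%:R).
  have XY : X ^+ 2 <= H%:R * M%:R * (L%:R * (H%:R * M%:R + 2 * Y)).
    have XH := @box_sum_upd_sqr_le R P t H L D M%:R g g1 gM i beta
      (fun c => lam (upd beta i c)) t0 (fun c => lam1 _).
    exact: XH.
  have inj : forall a b : nat, (a <= P.-1)%N -> (b <= P.-1)%N ->
      a%:R = b%:R :> 'F_P -> a = b.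
    have P0 := prime_gt0 primeP.
    by move=> a b aP bP; apply: natr_Fp_inj; rewrite // -(prednK P0).
  have YT := sum_normc_autocorr_dilates_sqr_le (2 * D) H (g1 i) (gM i).
  have TV : autocorr_grid_sum (g i) (2 * D) H ^+ 2 <=
      72 * (2 * D * H)%:R ^+ 3 * gowersV 1 (g i).
    by apply: (autocorr_grid_sum_sqr_le inj); move: P4; clear; lia.
  rewrite -/Y in YT.
  have Y0 : 0 <= Y by apply: sumr_ge0 => ? _; exact: normc_ge0.
  have YV : Y ^+ 4 <= M%:R ^+ 2 * (72 * ((2 * D)%:R * H%:R) ^+ 3 * gowersV 1 (g i)).
    rewrite -natrM (exprM Y 2 2).
    apply: (@le_trans _ _ ((M%:R * autocorr_grid_sum (g i) (2 * D) H) ^+ 2)).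
      have Y20 : 0 <= Y ^+ 2 by exact: sqr_ge0.
      by rewrite lerXn2r ?nnegrE //; exact: le_trans YT.
    by rewrite exprMn ler_wpM2l // sqr_ge0.
  have Xge : a1 * d * (B * N * H%:R) <= X.
    have c0 : 0 < (3 * C0 * B) ^+ t by rewrite exprn_gt0 // mulr_gt0.
    rewrite -(ler_pM2l c0).
    apply: (@le_trans _ _ (L%:R ^+ t * X)); last first.
      by apply: ler_wpM2r; [exact: normc_ge0 | exact: LtB].
    apply: le_trans LX; apply: le_trans SR; rewrite le_eqVlt.
    apply/orP; left; apply/eqP; rewrite /a1 exprMn exprS; field.
    by rewrite expf_neq0 // gt_eqF.
  have {}iter := iter _ (g i) (window P M) N d (gE i).
  rewrite prednK // in iter; rewrite -(prednK t0) in iter *; apply: iter => //.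
  (* [card_win] needs a positive length; for [M = 0] the window has at most one element. *)
  - case: (posnP M) => [M00|/card_win Mw]; last by apply: le_trans Mw _; lra.
    apply: (@le_trans _ _ 1); last by lra.
    by rewrite M00 (ler_nat R _ 1); exact: card_window.
  - exact: ltW.
  have -> : k0 * d ^+ 8 * N ^+ 3 =
      (a1 ^+ 2 * d ^+ 2 / (12 * C0)) ^+ 4 / (576 * C0 ^+ 3) * N ^+ 3.
    by rewrite /k0; field; rewrite gt_eqF //; lra.
  apply: (large_B_estimate h0 B0 BhN C1 d0 a10 _ _ _ Y0 (V0 1%N) Xge XY YV).
  - by rewrite M0.
  - by rewrite LB ltW.
  - by rewrite ler0n natrM; lra.
  have -> : a1 ^+ 2 * d ^+ 2 * B = B * d ^+ 2 * a1 ^+ 2 by ring.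
  by rewrite -ler_pdivrMr ?exprn_gt0.
(* Small [B]: a single [beta] without coincidences leads to [gowersV t] directly. *)
apply: (@le_trans _ _ (k2 * d ^+ (2 ^ t.+2) * N ^+ t.+2)).
  by apply: (ler_wpM2r Npow0); apply: (ler_wpM2r dpow0).
set S := d * _ in SR.
have S0 : 0 < S by rewrite /S !mulr_gt0 // exprn_gt0.
have bad : 2 * (t.+1%:R * L%:R ^+ t * (H%:R * M%:R)) <= S.
  have hMN : H%:R * M%:R <= N * H%:R by rewrite mulrC ler_wpM2r // ltW.
  have x0 : 0 <= t.+1%:R * (3 * C0 * B) ^+ t.
    by rewrite mulr_ge0 // exprn_ge0 // mulr_ge0 ?ltW.
  apply: (@le_trans _ _ (2 * (t.+1%:R * (3 * C0 * B) ^+ t * (N * H%:R)))).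
    have y0 : 0 <= t.+1%:R * L%:R ^+ t :> R by exact: mulr_ge0 (exprn_ge0 _ _).
    have y1 : t.+1%:R * L%:R ^+ t <= t.+1%:R * (3 * C0 * B) ^+ t.
      by apply: ler_wpM2l => //; exact: LtB.
    have z0 : 0 <= H%:R * M%:R :> R by exact: mulr_ge0.
    by apply: ler_wpM2l => //; exact: (ler_pM y0 z0 y1 hMN).
  have -> : 2 * (t.+1%:R * (3 * C0 * B) ^+ t * (N * H%:R)) =
      C' * (B ^+ t * (N * H%:R)) by rewrite /C' [(3 * C0 * B) ^+ t]exprMn; ring.
  have -> : S = d * B * (B ^+ t * (N * H%:R)) by rewrite /S exprS; ring.
  by apply: ler_wpM2r => //; rewrite !mulr_ge0 ?exprn_ge0 ?ltW.
have [beta betai Sbeta] := exists_distinct_large g1 gM i lam1 S0 bad SR.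
have boxV := box_sum_pow_le primeP D g1 gM LP HP betai.
apply: (small_B_estimate h0 BhN N0 _ a20 K00 (ltW BK) (V0 t)
  (S := normc (box_sum H D g beta))).
- by rewrite d0.
- have c0 : 0 < 2 * (3 * C0 * B) ^+ t.+1 by rewrite mulr_gt0 // exprn_gt0 // mulr_gt0.
  rewrite -(ler_pM2l c0); apply: (@le_trans _ _ S).
    rewrite le_eqVlt; apply/orP; left; apply/eqP; rewrite /a2 /S exprMn; field.
    by rewrite expf_neq0 // gt_eqF.
  apply: le_trans Sbeta _; apply: ler_wpM2r; first exact: normc_ge0.
  by apply: ler_wpM2l => //; exact: LtB.
apply: le_trans boxV _; apply: (ler_wpM2r (V0 t)); rewrite config_const_closed.
apply: ler_wpM2r; first exact: sqr_ge0.
apply: ler_pM; rewrite ?exprn_ge0 //.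
  by rewrite lerXn2r ?nnegrE // ltW.
by rewrite lerXn2r ?nnegrE ?mulr_ge0 ?card_win.
Qed.

(** * Integer parts and the indicator of [N] *)

Section Intervals.
Variable R : realType.

Lemma absz_floor (x : R) : 0 <= x -> (`|Num.floor x|%N)%:Z = Num.floor x.
Proof. by move=> x0; rewrite gez0_abs // floor_ge0. Qed.

Lemma absz_floor_le (x : R) : 0 <= x -> (`|Num.floor x|%N)%:R <= x.
Proof. by move=> x0; rewrite pmulrn absz_floor // floor_le. Qed.

Lemma absz_le_floor (x : R) (z : int) : - x <= z%:~R <= x ->
  (`|z| <= `|Num.floor x|)%N.
Proof.
move=> /andP[zl zr].
have h1 : z <= Num.floor x by rewrite floor_ge_int.
have h2 : - z <= Num.floor x by rewrite floor_ge_int intrN; lra.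
lia.
Qed.

Lemma bracketE (x : R) (n : int) : 0 <= x ->
  bracket x n = (1 <= n <= (`|Num.floor x|%N)%:Z) :> Prop.
Proof. by move=> x0; rewrite absz_floor. Qed.

Lemma normc_one_bounded (T : Type) (f : T -> R[i]) x :
  one_bounded f -> normc (f x) <= 1.
Proof. by move=> /(_ x); rewrite -normr_le_real. Qed.

Lemma in_interval_indic (N : R) : 0 <= N ->
  in_interval `|Num.floor N|%N (\1_(bracket N) : int -> R[i]).
Proof.
by move=> N0 x; rewrite indicE pnatr_eq0 eqb0 negbK inE -bracketE.
Qed.

(** The denominator of the norm is nonzero: a 0-1 function equals its derivative with shift 0, so
    [gowersV 0] is a lower bound, and 1 lies in [N]. *)
Lemma gowersV_indic_gt0 (P : nat) (N : R) s : prime P -> 1 <= N ->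
  (2 < P)%N -> 0 < gowersV s (lift_Fp (P := P) (\1_(bracket N) : int -> R[i])).
Proof.
move=> primeP N1 P2; set g := lift_Fp _.
have gE y : g y = (crep y \in bracket N)%:R by rewrite /g /lift_Fp indicE.
apply: (@lt_le_trans _ _ (gowersV 0 g)); last first.
  apply: gowersV_ge_mdiff0 => y; rewrite /mdiff addr0 !gE.
  by case: (_ \in _); [rewrite mul1r; exact: conjc1 | rewrite mul0r].
rewrite /= exprn_gt0 //; under eq_bigr do rewrite gE.
rewrite -natr_sum -(rmorph_nat (real_complex R)) normc_real ?ler0n // ltr0n.
rewrite (bigD1 (1%:~R : 'F_P)) //= crep_intr // mem_set //.
by rewrite /bracket /= floor_ge_int.
Qed.

End Intervals.

(** * Choice of constants and passage to normalised norms *)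

Theorem proposition3p7 (R : realType) (k : nat) (hk : (2 <= k)%N)
    (C0 : R) (hC0 : 1 <= C0) :
  exists c C' c1 : R, [/\ 0 < c, 0 < C', 0 < c1 &
    forall (N delta : R) (H : nat),
      let B := N / H%:R in
      1 <= N -> 0 < delta -> delta < c -> (0 < H)%N ->
      C' * delta^-1 <= B ->
      C' * delta ^- (2 ^ (k - 1)) <= H%:R ->
      forall (lam : {ffun 'I_k -> int} -> R[i]) (f : 'I_k -> int -> R[i]),
        one_bounded lam ->
        supported_on lam
          [set b : {ffun 'I_k -> int} | forall i, - (C0 * B) <= (b i)%:~R <= C0 * B] ->
        (forall i, one_bounded (f i)) ->
        (forall i, supported_on (f i) (bracket N)) ->
        (delta * B ^+ k * (N ^+ 2 / B))%:C <= `|counting_op H lam f| ->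
        forall i : 'I_k,
          c1 * (delta ^+ (2 ^ (k - 1)) /
                (ln (2 / delta)) `^ ((2 ^+ (k - 1) - 1) / 2 ^+ k))
          <= gowers_norm_on k N (f i)].
Proof.
case: k hk => [//|t] t0; rewrite subSS subn0 in t0 *.
have [k1 [C' [k10 C'1 key]]] := box_gowersV_lower t0 hC0.
pose s : R := 1 / 2 ^+ t.+1.
have s0 : 0 < s by rewrite divr_gt0 ?exprn_gt0.
have k13 : 0 < k1 / 3 ^+ t by rewrite divr_gt0 ?exprn_gt0.
(* The value 1/e ensures [d <= 1] and ln (2 / d) >= 1. In the last constant, 3^t comes from the
   upper bound for the Gowers sum of the indicator of [N]. *)
exists (expR 1)^-1, C', ((k1 / 3 ^+ t) `^ s).
split; [by rewrite invr_gt0 expR_gt0 | by apply: lt_le_trans C'1 | exact: powR_gt0 |].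
move=> N d H B N1 d0 dc H0 CB _ lam f lam1 lamB f1 fN RH i.
have e1 : 1 <= expR 1 :> R by rewrite -{1}expR0 ler_expR.
have d1 : d <= 1.
  by apply: le_trans (ltW dc) _; rewrite invf_le1 // expR_gt0.
have N0 : 0 < N by apply: lt_le_trans N1.
have h0 : 0 < H%:R :> R by rewrite ltr0n.
have B0 : 0 < B by rewrite divr_gt0.
have CdB : C' <= d * B by rewrite -ler_pdivrMl // mulrC.
have CB0 : 0 <= C0 * B by apply: mulr_ge0; [exact: le_trans hC0 | exact: ltW].
set M := `|Num.floor N|%N; set D := `|Num.floor (C0 * B)|%N.
(* One prime beyond every bound needed against wrap-around. *)
have [P mP primeP] := prime_above
  (2 * (M + 2 * (D * H)) + 4 * (D * H) + H + (2 * D).+1 + 2 * (t.+2 * M) + 2).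
have [P1 P2 P3 [P4 P5 P6]] : [/\ (2 * (M + 2 * (D * H)) < P)%N, (4 * (D * H) < P)%N,
    (H < P)%N & [/\ ((2 * D).+1 <= P)%N, (2 * (t.+2 * M) < P)%N & (2 < P)%N]].
  clear -mP; move: mP; move: (D * H)%N (t.+2 * M)%N => u v mP.
  by split; [lia | lia | lia | split; lia].
have fM j : in_interval M (f j).
  by move=> x /fN; rewrite bracketE // ltW.
have lamD b : lam b != 0 -> forall j, (`|b j| <= D)%N.
  by move=> /lamB bB j; exact: absz_le_floor.
pose g j := lift_Fp (P := P) (f j).
have g1 j y : normc (g j y) <= 1 := normc_one_bounded (crep y) (f1 j).
have supp (u : int -> R[i]) : in_interval M u ->
    #|[pred y | lift_Fp (P := P) u y != 0%R]|%:R <= M%:R :> R.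
  by move=> uM; rewrite ler_nat; exact: card_supp_lift.
have MN : M%:R <= N by apply: absz_floor_le; exact: ltW.
have RHB : d * (B ^+ t.+1 * (N * H%:R)) <=
    normc (\sum_(beta : {ffun 'I_t.+1 -> 'I_(2 * D).+1})
      lam (box_point beta) * box_sum H D g beta).
  have CE : counting_op H lam f =
      \sum_(beta : {ffun 'I_t.+1 -> 'I_(2 * D).+1})
        lam (box_point beta) * box_sum H D g beta.
    exact: (counting_op_box primeP P1 fM lamD).
  rewrite -CE -normr_ge_real.
  apply: le_trans RH; rewrite lecR le_eqVlt; apply/orP; left; apply/eqP.
  by rewrite -mulrA /B; congr (_ * (_ * _)); field; rewrite !gt_eqF.
have Vf : k1 * d ^+ (2 ^ t.+2) * N ^+ t.+2 <= gowersV t (g i).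
  apply: (key P H D M N d g (fun beta => lam (box_point beta))) => //.
  - by rewrite d0.
  - exact: absz_floor_le.
  - by move=> j; apply: supp.
  - by move=> j; exact: diffs_in_window.
  - by move=> beta; exact: normc_one_bounded.
pose u : int -> R[i] := \1_(bracket N).
have uM : in_interval M u by apply: in_interval_indic; exact: ltW.
have Vu0 : 0 < gowersV t (lift_Fp (P := P) u) by exact: gowersV_indic_gt0.
have Vu : gowersV t (lift_Fp (P := P) u) <= 3 ^+ t * N ^+ t.+2.
  have u1 y : normc (lift_Fp (P := P) u y) <= 1.
    rewrite /lift_Fp /u indicE; case: (_ \in _); first by rewrite normc1.
    by rewrite normc0.
  apply: le_trans (gowersV_le t (diffs_in_window primeP uM) u1 (supp u uM)) _.
  have -> : 3 ^+ t * N ^+ t.+2 = (3 * N) ^+ t * N ^+ 2.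
    by rewrite exprMn -mulrA -exprD addn2.
  apply: ler_pM; rewrite ?exprn_ge0 ?sqr_ge0 //.
    rewrite lerXn2r ?nnegrE ?mulr_ge0 ?(ltW N0) //.
    apply: le_trans (_ : (2 * M).+1%:R <= _); first by rewrite ler_nat card_window.
    by rewrite -natr1 natrM; lra.
  by rewrite lerXn2r ?nnegrE ?(ltW N0).
have normE (w : int -> R[i]) : in_interval M w ->
    gowers_norm t.+1 w = gowersV t (lift_Fp (P := P) w) `^ s.
  by move=> wM; rewrite /gowers_norm (gowers_sum_gowersV primeP wM P5).
have fE : (fun x => f i x * \1_(bracket N) x) = f i.
  apply/funext => x; rewrite indicE; have [fx0|fx0] := eqVneq (f i x) 0.
    by rewrite fx0 mul0r.
  by rewrite (mem_set (fN i x fx0)) mulr1.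
rewrite /gowers_norm_on fE (normE _ (fM i)) (normE _ uM).
rewrite ler_pdivlMr ?powR_gt0 //.
have dt0 : 0 <= d ^+ (2 ^ t.+2) by rewrite exprn_ge0 // ltW.
have kd0 : 0 <= k1 / 3 ^+ t * d ^+ (2 ^ t.+2) by rewrite mulr_ge0 ?(ltW k13).
have main : (k1 / 3 ^+ t * d ^+ (2 ^ t.+2) * gowersV t (lift_Fp (P := P) u)) `^ s <=
    gowersV t (g i) `^ s.
  apply: ge0_ler_powR; rewrite ?nnegrE ?gowersV_ge0 ?(ltW s0) //.
    by rewrite mulr_ge0 // gowersV_ge0.
  apply: le_trans Vf; apply: le_trans (ler_wpM2l kd0 Vu) _.
  rewrite le_eqVlt; apply/orP; left; apply/eqP; field.
  by rewrite expf_neq0.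
apply: le_trans main; rewrite [leRHS]powRM ?gowersV_ge0 //.
rewrite [X in _ <= X * _]powRM ?(ltW k13) //.
apply: ler_wpM2r; first exact: powR_ge0.
apply: ler_wpM2l; first exact: powR_ge0.
(* The exponent 2^(t+2) times [s] is 2: the norm is at least a constant times d^2. *)
have -> : (d ^+ (2 ^ t.+2)) `^ s = d ^+ 2.
  rewrite -!powR_mulrn ?(ltW d0) // -powRrM; congr (_ `^ _).
  by rewrite /s expnSr natrM natrX; field; rewrite expf_neq0.
have lg : 1 <= ln (2 / d) `^ ((2 ^+ t - 1) / 2 ^+ t.+1).
  have ln1 : 1 <= ln (2 / d).
    rewrite -[leLHS](expRK 1) ler_ln ?posrE ?expR_gt0 ?divr_gt0 //.
    rewrite ler_pdivlMr // -ler_pdivlMl ?expR_gt0 //.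
    apply: le_trans (ltW dc) _; apply: ler_peMr; last by rewrite ler1n.
    by rewrite invr_ge0 expR_ge0.
  rewrite -[leLHS](powRr0 (ln (2 / d))) ler_powR // divr_ge0 ?exprn_ge0 //.
  by rewrite subr_ge0 exprn_ege1 // ler1n.
(* The power of the logarithm is at least 1, and d^(2^t) <= d^2 since t >= 1 and d <= 1. *)
apply: (@le_trans _ _ (d ^+ (2 ^ t))).
  rewrite ler_pdivrMr; last exact: lt_le_trans lg.
  by apply: ler_peMr; [rewrite exprn_ge0 // ltW | exact: lg].
apply: ler_wiXn2l => //; first exact: ltW.
by rewrite -{1}(expn1 2) leq_exp2l.
Qed.
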